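(* There is an absolute constant $C>0$ such that, for every prime $p$ and every set $A$ of generators of $G_p = \mathrm{SL}_2(\mathbb{Z}/p\mathbb{Z})$, the diameter of $G_p$ with respect to $A$ is at most $C(\log |G_p|)^{C}$.
   Context: For a finite group $G$ and a set $A\subset G$ generating $G$ (not assumed closed under inversion), the diameter of $G$ with respect to $A$ is the least $k$ such that every $g\in G$ can be written as $g = x_1x_2\cdots x_r$ with $x_i\in A$ and $r\le k$. ''Absolute constant'' means that $C$ depends neither on $p$ nor on $A$. *)

(* Defs.v *)
From HB Require Import structures.
From mathcomp Require Import all_boot all_order all_algebra all_fingroup.

Set Implicit Arguments.
Unset Strict Implicit.
Unset Printing Implicit Defensive.

Import GroupScope.

Section SL2.
Variable F : finFieldType.

(* SL_2(F), realised inside the library's GL_2(F). *)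
Definition SL2 : {set {'GL_2[F]}} := [set u | (\det (GLval u) == 1)%R].

Lemma SL2_group_set : group_set SL2.
Proof.
apply/group_setP; split => [|u v]; first by rewrite inE GL_1E det1.
by rewrite !inE GL_ME det_mulmx => /eqP -> /eqP ->; rewrite GRing.mulr1.
Qed.

Canonical SL2_group := Group SL2_group_set.

End SL2.

Section Diameter.
Variables (gT : finGroupType) (G : {group gT}) (A : {set gT}).

(* A ^+ r is the setwise power, the set of all products x_1 * ... * x_r with
   every x_i in A.  The empty product (r = 0) is allowed, so that the identity
   has length 0. *)
Definition covered_by_length (k : nat) : bool :=
  [forall g in G, exists r : 'I_k.+1, g \in A ^+ r].

(* <<A>> is the subgroup generated by A; since G is finite, every element of it
   is a product of elements of A, without inverses. *)
Lemma ex_covered_by_length : <<A>> = G -> exists k, covered_by_length k.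
Proof.
have [n ->] := gen_expgs A => defG.
exists n; apply/forall_inP => g; rewrite -defG => {defG}.
elim: n g => [|n IHn] g; first by move=> gA; apply/existsP; exists ord0.
rewrite expgS => /mulsgP[x y + /IHn/existsP[r yA] ->].
rewrite !inE => /orP[/eqP-> | Ax]; apply/existsP.
  by exists (widen_ord (leqnSn n.+1) r); rewrite mul1g.
by exists (lift ord0 r); rewrite lift0 expgS mem_mulg.
Qed.

Definition diameter (genA : <<A>> = G) : nat :=
  ex_minn (ex_covered_by_length genA).

End Diameter.

(* Main.v *)
Require Import Defs.
From HB Require Import structures.
From mathcomp Require Import all_boot all_order all_algebra all_fingroup.
From mathcomp Require Import reals exp.
From mathcomp Require Import zify ring.

(** The growth argument for SL_2 in pivoting form, over a finite field [F] with
    [q] elements in which 2 and 3 are invertible.  Let [A] be a symmetric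
    generating set containing 1 and let [N = |A^12|].

    A conjugacy class of trace [t], where [t] is not 0, 2 or -2, is a surface, and
    [A] meets it in [O(N^(2/3))] points: the map
    [(x1, x2, x3) |-> (x1 x2, x1 x3)] on triples of such points has generic fibres
    of size at most 2.  Hence, as soon as [A^2] meets a maximal torus in an
    element [y] with [tr y] not in {0, 2, -2}, orbit counting for the conjugation
    of [y] by [A] shows that [A^2] meets that torus in many points.  If [A] does
    not grow then every conjugate of this torus by an element of [A], hence by an
    element of the whole group, is again met by [A^2] in this way, and summing
    over the conjugates gives [|A| >= |G|^(1 - epsilon)].  Such a large set
    contains many upper unipotent and many diagonal matrices; a second moment
    argument in [F] then produces all unipotents, and therefore all of [G], as
    words of bounded length.

    So either a bounded power of [A] is everything or [|A^12| >= |A|^(1 + delta)],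
    and iterating bounds the undirected diameter polylogarithmically.  The
    directed diameter is larger by a factor [O(log |G|)] only: if the undirected
    diameter is [d] then some [a] in [A] moves a proportion at least [1 / 2d] of
    any given set of at most [|G| / 2] elements outside this set. *)

Set Implicit Arguments.
Unset Strict Implicit.
Unset Printing Implicit Defensive.

Import GroupScope Order.TTheory GRing.Theory Num.Theory.

(** * Powers of subsets of a finite group *)

(* The finType structure of a finGroupType is reached through two convertible
   but syntactically different paths, which hides equal cardinals from lia. *)
Ltac abstract_cards :=
  repeat match goal with
  | H : is_true (leq _ _) |- _ => move: H
  | H : @eq nat _ _ |- _ => move: H
  | H : _ \/ _ |- _ => move: H
  end;
  repeat match goal with
  | |- context [@card.body ?T ?P] =>
    let n := fresh "card" in
    set n := (@card.body T P);
    repeat match goal with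
    | |- context [@card.body ?T' ?P'] => change (@card.body T' P') with n
    end;
    clearbody n
  end.
Ltac clia := abstract_cards; lia.
Ltac cnia := abstract_cards; nia.

Lemma card_le_fibers (T U : finType) (f : T -> U) (D : {set T}) (E : {set U})
    (c : nat) :
  (forall x, x \in D -> f x \in E) ->
  (forall y, y \in E -> #|[set x in D | f x == y]| <= c) ->
  #|D| <= c * #|E|.
Proof.
move=> fDE fib; rewrite -sum1_card (partition_big f (mem E)) //=.
rewrite mulnC -sum_nat_const; apply: leq_sum => y yE.
by rewrite (leq_trans _ (fib y yE)) // sum1dep_card cardsE.
Qed.

Section Powers.
Variable gT : finGroupType.
Implicit Types (A B : {set gT}) (x y : gT) (G K : {group gT}).

Lemma expgs_one A n : 1 \in A -> 1 \in A ^+ n.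
Proof.
move=> A1; elim: n => [|n IHn]; first by rewrite expg0 set11.
by rewrite expgS -[1 in X in X \in _]mulg1 mem_mulg.
Qed.

Lemma expgs_leq A m n : 1 \in A -> m <= n -> A ^+ m \subset A ^+ n.
Proof.
move=> A1 /subnKC <-; rewrite expgD.
by apply: mulg_subl; apply: expgs_one.
Qed.

Lemma expgs_sub G A n : A \subset G -> A ^+ n \subset G.
Proof.
move=> sAG; elim: n => [|n IHn]; first by rewrite expg0 sub1G.
by rewrite expgS mul_subG.
Qed.

Lemma expgs_inv A n : A^-1 = A -> (A ^+ n)^-1 = A ^+ n.
Proof.
move=> AV; elim: n => [|n IHn]; first by rewrite expg0 invg1.
by rewrite expgS invMg IHn AV -expgSr -expgS.
Qed.

Lemma mem_expgsD A m n x y :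
  x \in A ^+ m -> y \in A ^+ n -> x * y \in A ^+ (m + n).
Proof. by move=> xA yA; rewrite expgD mem_mulg. Qed.

Lemma mem_expgsV A n x : A^-1 = A -> x \in A ^+ n -> x^-1 \in A ^+ n.
Proof. by move=> AV xA; rewrite -(expgs_inv _ AV) memV_invg. Qed.

Lemma mem_expgs_twist A m n x y z : A^-1 = A -> x * y = z * x ->
  x \in A ^+ m -> y \in A ^+ n -> z \in A ^+ (m + n + m).
Proof.
move=> AV xyz xA yA; have -> : z = x * y * x^-1 by rewrite xyz mulgK.
by rewrite !mem_expgsD ?mem_expgsV.
Qed.

Lemma gen_expgs_pos A n : 0 < n -> 1 \in A -> <<A ^+ n>> = <<A>>.
Proof.
move=> n0 A1; apply/eqP; rewrite eqEsubset !gen_subG.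
rewrite expgs_sub ?subset_gen //=.
by apply: subset_trans (subset_gen _); rewrite -{1}[A]expg1 expgs_leq.
Qed.

Lemma expgs_stable A n : 1 \in A -> A ^+ n.+1 = A ^+ n -> <<A>> = A ^+ n.
Proof.
move=> A1 stab; apply/eqP; rewrite eqEsubset.
rewrite expgs_sub ?subset_gen // andbT.
have [m ->] := gen_expgs A.
have ->: 1 |: A = A by apply/setUidPr; rewrite sub1set.
have stabD k : A ^+ (n + k) = A ^+ n.
  by elim: k => [|k IHk]; rewrite ?addn0 // addnS expgS IHk -expgS.
by rewrite -(stabD m) expgs_leq ?leq_addl.
Qed.

(** The powers increase, and once two consecutive ones agree they have reached [<<A>>]; every
    earlier step gains an element. *)
Lemma card_expgs_gt G A n :
  1 \in A -> <<A>> = G -> n < #|G| -> n < #|A ^+ n|.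
Proof.
move=> A1 genA; elim: n => [|n IHn] ltnG.
  by rewrite expg0 cards1.
have sub := expgs_leq A1 (leqnSn n).
have := IHn (ltnW ltnG); rewrite leq_eqVlt => /orP[/eqP cardn | ltn]; last first.
  exact: leq_trans (subset_leq_card sub).
have [eqn|neqn] := eqVneq (A ^+ n.+1) (A ^+ n).
  by move: ltnG; rewrite -genA (expgs_stable A1 eqn) cardn ltnn.
by rewrite {1}cardn proper_card // properEneq eq_sym neqn.
Qed.

Lemma expgs_card G A : 1 \in A -> <<A>> = G -> A ^+ #|G| = G.
Proof.
move=> A1 genA; have sAG : A \subset G by rewrite -genA subset_gen.
have G0 := cardG_gt0 G.
apply/eqP; rewrite eqEcard expgs_sub //=.
rewrite -{1}(prednK G0); apply: leq_trans (subset_leq_card (expgs_leq A1 (leq_pred _))).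
by apply: (card_expgs_gt A1 genA); rewrite ltn_predL.
Qed.

(** Pigeonhole: [A] and [g *: A^-1] each fill more than half of [G], so they meet, and a common
    element factors [g]. *)
Lemma mulg_big G A : A \subset G -> #|G| < 2 * #|A| -> A * A = G.
Proof.
move=> sAG big; apply/eqP; rewrite eqEsubset mul_subG //=.
apply/subsetP => g gG.
have : #|A| + #|g *: A^-1| > #|G|.
  by rewrite card_lcoset card_invg addnn -mul2n.
rewrite -cardsUI => lt.
have sUG : A :|: g *: A^-1 \subset G.
  rewrite subUset sAG; apply/subsetP => x /lcosetP[y yA ->].
  by rewrite groupM // -groupV (subsetP sAG) // -mem_invg.
have : 0 < #|A :&: g *: A^-1|.
  by have := subset_leq_card sUG; case: #|_ :&: _| lt => // ;
    rewrite addn0 ltnNge => /negP.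
case/card_gt0P => x; rewrite inE => /andP[xA /lcosetP[y yA def_x]].
have -> : g = x * y^-1 by rewrite def_x mulgK.
by rewrite mem_mulg // -mem_invg.
Qed.

(** Points [(a, k)] and [(a0, k0)] in one fibre of the product map satisfy [a0^-1 * a = k0 * k^-1],
    so each fibre embeds into the slice. *)
Lemma card_subgroup_slice G K A :
  A \subset G -> K \subset G -> #|A| * #|K| <= #|A^-1 * A :&: K| * #|G|.
Proof.
move=> sAG sKG; rewrite -[leqLHS]cardsX.
apply: (@card_le_fibers _ _ (fun u : gT * gT => u.1 * u.2) _ G _ _ _).
  by case=> a k /setXP[] /= aA kK; rewrite groupM ?(subsetP sAG _ aA) ?(subsetP sKG).
move=> g gG; set D := [set _ in _ | _].
have [-> | [[a0 k0]]] := set_0Vmem D; first by rewrite cards0.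
rewrite !inE /= => /andP[/andP[a0A k0K] /eqP g_eq].
have inj : {in D &, injective (fun u => a0^-1 * u.1)}.
  move=> [a k] [a' k']; rewrite !inE /= => /andP[_ /eqP e] /andP[_ /eqP e'].
  by move/mulgI => eaa; move: e' ; rewrite -e eaa => /mulgI ->.
rewrite -(card_in_imset inj); apply: subset_leq_card.
apply/subsetP => _ /imsetP[[a k] + ->]; rewrite !inE /= => /andP[/andP[aA kK] /eqP e].
rewrite mem_mulg ?memV_invg //=.
have -> : a0^-1 * a = k0 * k^-1.
  by apply: (mulIg k); rewrite mulgKV -mulgA e -g_eq mulKg.
by rewrite groupM ?groupV.
Qed.

Lemma cent1_conj (x z g : gT) : (z \in 'C[x ^ g]) = (z ^ g^-1 \in 'C[x]).
Proof. by rewrite cent1J mem_conjg. Qed.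

Lemma cent1_quotient (z g h : gT) : z ^ g = z ^ h -> h * g^-1 \in 'C[z].
Proof.
move=> eqz; apply/cent1P/commute_sym.
by rewrite /commute conjgC conjgM -eqz conjgK.
Qed.

Lemma cent1_mulE (x y : gT) : y \in 'C[x] -> x * y = y * x.
Proof. by move/cent1P. Qed.

Lemma expgs_conj A g n : (A :^ g) ^+ n = (A ^+ n) :^ g.
Proof.
elim: n => [|n IHn]; first by rewrite !expg0 conjs1g.
by rewrite !expgS IHn conjsMg.
Qed.

(** Used with a Weyl element [w] to pass from upper to lower unipotents; [B] is the conjugate of [A]
    by [w^-1]. *)
Lemma conj_set G A w : A \subset G -> 1 \in A -> A^-1 = A -> w \in G ->
  exists B, [/\ B \subset G, 1 \in B, B^-1 = B, #|B| = #|A| &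
    forall n x y, x \in B ^+ n -> x * w = w * y -> y \in A ^+ n].
Proof.
move=> sAG A1 AV wG; exists (A :^ w^-1); split.
- by rewrite conj_subG ?groupV.
- by rewrite mem_conjg invgK conj1g.
- by apply/setP => x; rewrite inE !mem_conjg invgK conjVg -mem_invg AV.
- by rewrite cardJg.
move=> n x y; rewrite expgs_conj mem_conjg invgK conjgE => + xy.
by rewrite xy mulKg.
Qed.

Lemma symmetric_closure_inv A : (1 |: (A :|: A^-1))^-1 = 1 |: (A :|: A^-1).
Proof.
by apply/setP=> x; rewrite 2!inE [in RHS]inE !inE invg_eq1 invgK [(x^-1 \in A) ||
  _]orbC.
Qed.

Lemma gen_symmetric_closure A : <<1 |: (A :|: A^-1)>> = <<A>>.
Proof.
apply/eqP; rewrite eqEsubset gen_subG !subUset sub1set group1 subset_gen /=.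
rewrite genS ?andbT; last by rewrite setUCA subsetUl.
by apply/subsetP=> x; rewrite mem_invg => /mem_gen; rewrite groupV.
Qed.

End Powers.

(** * Directed and undirected diameter *)

Section Directed.
Variables (gT : finGroupType) (G : {group gT}).
Implicit Types (A B X : {set gT}) (g h x : gT).

(** Averaging: over [g] in [G] the intersections [X :&: g *: X] have total size at most [#|X| ^ 2],
    so they cannot all exceed half of [X]. *)
Lemma translate_gap X :
  X \subset G -> 0 < #|X| -> 2 * #|X| <= #|G| ->
  exists2 g, g \in G & #|X| <= 2 * #|X :\: g *: X|.
Proof.
move=> sXG X0 small.
case: (pickP [pred g in G | #|X| <= 2 * #|X :\: g *: X|]) => [g /andP[? ?]|none].
  by exists g.
have big g : g \in G -> #|X| < 2 * #|X :&: g *: X|.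
  move=> gG; have := none g; rewrite /= gG /= => /negbT; rewrite -ltnNge.
  have := cardsID (g *: X) X; clia.
have count : \sum_(g in G) #|X :&: g *: X| <= #|X| * #|X|.
  under eq_bigr => g _ do rewrite -sum1_card.
  rewrite (exchange_big_dep (mem X)) /=; last by move=> g x _ /setIP[].
  rewrite -sum_nat_const; apply: leq_sum => x xX.
  rewrite sum1dep_card -(card_imset _ (inj_comp (mulIg x) invg_inj)).
  apply: subset_leq_card; apply/subsetP => _ /imsetP[g + ->] /=.
  by rewrite !inE => /andP[_ /andP[_]]; rewrite mem_lcoset.
have : \sum_(g in G) #|X|.+1 <= \sum_(g in G) 2 * #|X :&: g *: X|.
  exact: leq_sum.
rewrite sum_nat_const -big_distrr /= => /leq_trans/(_ (leq_mul (leqnn 2) count)).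
have := leq_mul small (leqnn #|X|); have := cardG_gt0 G; move=> *; exfalso; cnia.
Qed.

(** Translating [X :&: g^-1 *: X] by [g] gives [X :&: g *: X]. Inverses thus displace as much as
    generators do. *)
Lemma card_setD_lcosetV X g : #|X :\: g^-1 *: X| = #|X :\: g *: X|.
Proof.
have := cardsID (g *: X) X; have := cardsID (g^-1 *: X) X.
have -> : #|X :&: g^-1 *: X| = #|X :&: g *: X|; last by clia.
rewrite -(card_lcoset (X :&: g^-1 *: X) g).
congr #|pred_of_set _|; apply/setP => x.
by rewrite mem_lcoset !inE !mem_lcoset invgK mulKVg andbC.
Qed.

(** Displacement is subadditive: an element of [X] outside [(a * h) *: X] is outside [a *: X] or is
    the translate by [a] of an element of [X] outside [h *: X]. *)
Lemma card_setD_lcoset_expgs A X c n g :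
  (forall a, a \in A -> #|X :\: a *: X| <= c) ->
  g \in A ^+ n -> #|X :\: g *: X| <= n * c.
Proof.
move=> small; elim: n g => [|n IHn] g.
  by rewrite expg0 => /set1P ->; rewrite mul1g setDv cards0.
rewrite expgS => /mulsgP[a h aA hA ->].
have sub : X :\: (a * h) *: X \subset (X :\: a *: X) :|: a *: (X :\: h *: X).
  apply/subsetP => x; rewrite !inE !mem_lcoset !inE !mem_lcoset invMg -!mulgA.
  by case: (a^-1 * x \in X); case: (h^-1 * _ \in X); case: (x \in X).
apply: leq_trans (subset_leq_card sub) _.
apply: leq_trans (leq_card_setU _ _) _.
by rewrite card_lcoset mulSn leq_add ?small ?IHn.
Qed.

Variable A : {set gT}.
Hypothesis genA : <<A>> = G.

Let B := 1 |: A.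
Let S := 1 |: (A :|: A^-1).

Let B1 : 1 \in B. Proof. exact: setU11. Qed.
Let sBG : B \subset G.
Proof. by rewrite subUset sub1G -genA subset_gen. Qed.

(** Let [c] be the gain from [B ^+ n] to [B ^+ n.+1]. Generators and their inverses displace at most
    [c] elements of [X], products of [d] of them at most [d * c], and some group element displaces
    at least half of [X]. *)
Lemma directed_step d n : S ^+ d = G -> 2 * #|B ^+ n| <= #|G| ->
  #|B ^+ n| + 2 * d * #|B ^+ n| <= 2 * d * #|B ^+ n.+1|.
Proof.
move=> Sd small; set X := B ^+ n.
have sX : X \subset B ^+ n.+1 by rewrite expgs_leq.
have X0 : 0 < #|X| by apply/card_gt0P; exists 1; rewrite expgs_one.
pose c := #|B ^+ n.+1| - #|X|.
have gapA a : a \in A -> #|X :\: a *: X| <= c.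
  move=> aA; rewrite -card_setD_lcosetV.
  rewrite -(card_lcoset (X :\: a^-1 *: X) a).
  have -> : a *: (X :\: a^-1 *: X) = a *: X :\: X.
    by apply/setP=> x; rewrite mem_lcoset !inE !mem_lcoset invgK mulKVg.
  have : X :|: (a *: X :\: X) \subset B ^+ n.+1.
    rewrite subUset sX /= expgS; apply/subsetP => x /setDP[/lcosetP[y yX ->] _].
    by rewrite mem_mulg // !inE aA orbT.
  move/subset_leq_card; rewrite cardsU.
  have -> : X :&: (a *: X :\: X) = set0.
    by apply/setP => x; rewrite !inE; case: (x \in X).
  by rewrite cards0 /c; clia.
have gapS s : s \in S -> #|X :\: s *: X| <= c.
  rewrite !inE => /or3P[/eqP->|/gapA //|/gapA]; last by rewrite card_setD_lcosetV.
  by rewrite mul1g setDv cards0.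
have [g gG] := translate_gap (expgs_sub n sBG) X0 small.
rewrite -Sd in gG; have := card_setD_lcoset_expgs gapS gG.
have := subset_leq_card sX; rewrite /c -/X; cnia.
Qed.

(** The gains of [2 * d] steps add up to a doubling, until half of [G] is exceeded. Logarithmically
    many doublings suffice, and [mulg_big] finishes by one squaring, whence the factor 4. *)
Lemma directed_diameter d : S ^+ d = G ->
  B ^+ (4 * d * (trunc_log 2 #|G|).+1) = G.
Proof.
move=> Sd; pose b n := #|B ^+ n|.
have bmono m n : m <= n -> b m <= b n.
  by move=> lemn; apply: subset_leq_card; apply: expgs_leq.
have step n : 2 * b n <= #|G| -> b n + 2 * d * b n <= 2 * d * b n.+1.
  exact: directed_step Sd.
have b0 n : 0 < b n by apply/card_gt0P; exists 1; rewrite expgs_one.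
have bE n : #|B ^+ n| = b n by [].
have b01 : b 0 = 1%N by rewrite -bE expg0 cards1.
clearbody b.
have double n : #|G| < 2 * b (n + 2 * d) \/ 2 * b n <= b (n + 2 * d).
  have [|small] := ltnP #|G| (2 * b (n + 2 * d)); [by left | right].
  have add k : k <= 2 * d -> (2 * d + k) * b n <= 2 * d * b (n + k).
    elim: k => [|k IHk] lek; first by rewrite !addn0.
    have lek' : k <= 2 * d by clia.
    have := bmono n (n + k) (leq_addr _ _).
    have : 2 * b (n + k) <= #|G|.
      apply: leq_trans small; rewrite leq_mul2l bmono //.
      by rewrite leq_add2l.
    move/step; rewrite !addnS.
    have := IHk lek'; cnia.
  (* Cancelling [2 * d] needs [d] positive; for [d = 0] the group is trivial. *)
  have [d0|d0] := posnP d; last by have := add (2 * d)%N (leqnn _); cnia.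
  have := small; have := cardG_gt0 G.
  have -> : b (n + 2 * d) = b n by rewrite d0 muln0 addn0.
  have : #|G| = 1%N by rewrite -Sd d0 expg0 cards1.
  by have := b0 n; clia.
have pow (j : nat) : (#|G| < 2 * b (j * (2 * d)) \/ 2 ^ j <= b (j * (2 * d)))%N.
  elim: j => [|j IHj]; first by right; rewrite b01.
  rewrite (mulSn j) [(2 * d + _)%N]addnC;
    have := bmono _ _ (leq_addr (2 * d)%N (j * (2 * d))%N).
  have := double (j * (2 * d))%N; rewrite expnS.
  move: IHj; move: (2 ^ j)%N => P; clear; clia.
set L := trunc_log 2 #|G|.
have : (#|G| < 2 * b (L.+1 * (2 * d)))%N.
  case: (pow L.+1) => // lb; apply: leq_trans (trunc_log_ltn _ (isT : 1 < 2)) _.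
  by apply: leq_trans lb _; rewrite leq_pmull.
rewrite -bE => /(mulg_big (expgs_sub _ sBG)) <-.
by rewrite -expgD; congr (_ ^+ _); nia.
Qed.

End Directed.

(** * Two by two matrices *)

Local Open Scope ring_scope.

(** * Equations certified by explicit linear combinations *)

Section LinearCombinations.
Variable R : comPzRingType.
Implicit Types P Q k a b : R.

(** The cofactors [k1], [k2], ... are supplied by hand at each use; what remains is a polynomial or
    rational identity for [ring] or [field]. *)
Lemma eq_comb1 P Q k1 a1 b1 : a1 = b1 -> P - Q = k1 * (a1 - b1) -> P = Q.
Proof. by move=> ->; rewrite subrr mulr0 => /subr0_eq. Qed.

Lemma eq_comb2 P Q k1 a1 b1 k2 a2 b2 : a1 = b1 -> a2 = b2 ->
  P - Q = k1 * (a1 - b1) + k2 * (a2 - b2) -> P = Q.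
Proof. by move=> -> ->; rewrite !subrr !mulr0 addr0 => /subr0_eq. Qed.

Lemma eq_comb3 P Q k1 a1 b1 k2 a2 b2 k3 a3 b3 : a1 = b1 -> a2 = b2 -> a3 = b3 ->
  P - Q = k1 * (a1 - b1) + k2 * (a2 - b2) + k3 * (a3 - b3) -> P = Q.
Proof. by move=> -> -> ->; rewrite !subrr !mulr0 !addr0 => /subr0_eq. Qed.

Lemma eq_comb4 P Q k1 a1 b1 k2 a2 b2 k3 a3 b3 k4 a4 b4 :
  a1 = b1 -> a2 = b2 -> a3 = b3 -> a4 = b4 ->
  P - Q = k1 * (a1 - b1) + k2 * (a2 - b2) + k3 * (a3 - b3) + k4 * (a4 - b4) ->
  P = Q.
Proof. by move=> -> -> -> ->; rewrite !subrr !mulr0 !addr0 => /subr0_eq. Qed.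

End LinearCombinations.

(** The equations are the vanishing of the minors of the two vectors; [k] is read off at a nonzero
    coordinate of the first. *)
Lemma proportional (F : fieldType) (a b c a' b' c' : F) :
  ~~ [&& a == 0, b == 0 & c == 0] ->
  a * b' = a' * b -> b * c' = b' * c -> a * c' = a' * c ->
  exists k, [/\ a' = k * a, b' = k * b & c' = k * c].
Proof.
move=> abc0 ab bc ac; move: abc0; rewrite !negb_and => /or3P[] z0.
- exists (a' / a); split; [by field | |]; apply: (mulfI z0).
  + by apply: (eq_comb1 (k1 := 1) ab); field.
  + by apply: (eq_comb1 (k1 := 1) ac); field.
- exists (b' / b); split; [| by field |]; apply: (mulfI z0).
  + by apply: (eq_comb1 (k1 := -1) ab); field.
  + by apply: (eq_comb1 (k1 := 1) bc); field.
- exists (c' / c); split; [| | by field]; apply: (mulfI z0).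
  + by apply: (eq_comb1 (k1 := -1) ac); field.
  + by apply: (eq_comb1 (k1 := -1) bc); field.
Qed.

Lemma det_mx22 (R : comPzRingType) (M : 'M[R]_2) :
  \det M = M 0 0 * M 1 1 - M 0 1 * M 1 0.
Proof.
rewrite (expand_det_row _ 0) !big_ord_recl big_ord0 addr0 /cofactor !det_mx11 !mxE /=.
rewrite expr0 expr1 mul1r mulN1r mulrN.
by congr (_ * M _ _ - M _ _ * M _ _); apply: val_inj.
Qed.

(** * Matrix entries, traces and regular elements *)

Section Entries.
Variable F : finFieldType.
Local Notation gT := {'GL_2[F]}.
Implicit Types x y : gT.

Definition ea x : F := GLval x 0 0.
Definition eb x : F := GLval x 0 1.
Definition ec x : F := GLval x 1 0.
Definition ed x : F := GLval x 1 1.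
Definition tr x : F := ea x + ed x.

Lemma entriesP x y :
  ea x = ea y -> eb x = eb y -> ec x = ec y -> ed x = ed y -> x = y.
Proof.
rewrite /ea /eb /ec /ed => eqa eqb eqc eqd; apply/val_inj/matrixP.
have ord2 (k : 'I_2.-1.+1) : k = 0 \/ k = 1.
  by case: k => [[|[|//]] ltk]; [left | right]; apply: val_inj.
by move=> i j; case: (ord2 i) => ->; case: (ord2 j) => ->.
Qed.

Lemma SL2E x : (x \in SL2 F) = (ea x * ed x - eb x * ec x == 1).
Proof. by rewrite inE det_mx22. Qed.

Lemma SL2_det x : x \in SL2 F -> ea x * ed x - eb x * ec x = 1.
Proof. by rewrite SL2E => /eqP. Qed.

Lemma eaM x y : ea (x * y)%g = ea x * ea y + eb x * ec y.
Proof. by rewrite /ea GL_MxE mxE !big_ord_recl big_ord0 addr0; congr (_ + _ * _);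
  congr (GLval _ _ _); apply: val_inj. Qed.
Lemma ebM x y : eb (x * y)%g = ea x * eb y + eb x * ed y.
Proof. by rewrite /eb GL_MxE mxE !big_ord_recl big_ord0 addr0; congr (_ + _ * _);
  congr (GLval _ _ _); apply: val_inj. Qed.
Lemma ecM x y : ec (x * y)%g = ec x * ea y + ed x * ec y.
Proof. by rewrite /ec GL_MxE mxE !big_ord_recl big_ord0 addr0; congr (_ + _ * _);
  congr (GLval _ _ _); apply: val_inj. Qed.
Lemma edM x y : ed (x * y)%g = ec x * eb y + ed x * ed y.
Proof. by rewrite /ed GL_MxE mxE !big_ord_recl big_ord0 addr0; congr (_ + _ * _);
  congr (GLval _ _ _); apply: val_inj. Qed.

Definition mulE := (eaM, ebM, ecM, edM).

Lemma entries1 : (ea 1%g = 1) * (eb 1%g = 0) * (ec 1%g = 0) * (ed 1%g = 1).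
Proof. by rewrite /ea /eb /ec /ed GL_1E !mxE. Qed.

(** A singular matrix is sent to the default [1]; entries are read back only for determinant 1. *)
Definition mk (a b c d : F) : gT :=
  insubd (1%g : gT) (\matrix_(i < 2, j < 2)
    if i == 0 then if j == 0 then a else b else if j == 0 then c else d).

Lemma mk_entries a b c d : a * d - b * c = 1 ->
  (ea (mk a b c d) = a) * (eb (mk a b c d) = b) *
  (ec (mk a b c d) = c) * (ed (mk a b c d) = d).
Proof.
move=> det; rewrite /ea /eb /ec /ed /GLval -!/(FinRing.uval _) /mk.
by rewrite !insubdK ?mxE // unfold_in /= unitmxE det_mx22 !mxE /= det unitr1.
Qed.

Lemma mk_SL2 a b c d : a * d - b * c = 1 -> mk a b c d \in SL2 F.
Proof. by move=> det; rewrite SL2E !(mk_entries det) det. Qed.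

Lemma mk_eta x : x \in SL2 F -> mk (ea x) (eb x) (ec x) (ed x) = x.
Proof. by move=> /SL2_det det; apply: entriesP; rewrite (mk_entries det). Qed.

Lemma entriesV x : x \in SL2 F ->
  (ea x^-1%g = ed x) * (eb x^-1%g = - eb x) *
  (ec x^-1%g = - ec x) * (ed x^-1%g = ea x).
Proof.
move=> /SL2_det det; have det' : ed x * ea x - - eb x * - ec x = 1.
  by rewrite -det; ring.
suff -> : x^-1%g = mk (ed x) (- eb x) (- ec x) (ea x) by rewrite !(mk_entries det').
apply: (mulgI x); rewrite mulgV; apply: entriesP;
  rewrite !mulE !(mk_entries det') !entries1; first [by rewrite -det; ring | by ring].
Qed.

Lemma trMC x y : tr (x * y)%g = tr (y * x)%g.
Proof. by rewrite /tr !mulE; ring. Qed.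

Lemma trJ x y : tr (x ^ y)%g = tr x.
Proof. by rewrite conjgE trMC -mulgA mulgV mulg1. Qed.

(** Cayley-Hamilton: [y ^ 2 = tr y * y - 1] in determinant 1. *)
Lemma trMM x y : y \in SL2 F -> tr (x * y * y)%g = tr y * tr (x * y)%g - tr x.
Proof.
move=> /SL2_det det; rewrite /tr !mulE.
by apply: (eq_comb1 (k1 := - (ea x + ed x)) det); ring.
Qed.

Lemma mem_expgsM (A : {set gT}) m n x y :
  x \in (A ^+ m)%g -> y \in (A ^+ n)%g -> (x * y)%g \in (A ^+ (m + n))%g.
Proof. exact: mem_expgsD. Qed.

Lemma mem_expgs1 (A : {set gT}) x : x \in A -> x \in (A ^+ 1)%g.
Proof. by []. Qed.

Lemma mem_expgsJ (A : {set gT}) m n x y : A^-1%g = A ->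
  x \in (A ^+ m)%g -> y \in (A ^+ n)%g -> (x * y * x^-1)%g \in (A ^+ (m + n + m))%g.
Proof. by move=> AV xA yA; rewrite !mem_expgsD ?mem_expgsV. Qed.

Definition nonscalar x := ~~ [&& eb x == 0, ec x == 0 & ea x == ed x].

(* Trace 0 is excluded because the trace class then spans a linear hyperplane and
   [three_points_linked] fails. *)
Definition regular x := (tr x != 0) && (tr x ^+ 2 != 4%:R).

Lemma regular_nonscalar x : x \in SL2 F -> regular x -> nonscalar x.
Proof.
move=> /SL2_det det /andP[_ tr4];
  apply: contraNN tr4 => /and3P[/eqP b0 /eqP c0 /eqP ad].
move: det; rewrite b0 c0 ad => det; rewrite /tr ad.
by apply/eqP; apply: (eq_comb1 (k1 := 4%:R) det); ring.
Qed.

Lemma regularJ x y : regular (x ^ y)%g = regular x.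
Proof. by rewrite /regular trJ. Qed.

End Entries.

Lemma gen_mul_ind (gT : finGroupType) (A : {set gT}) (P : gT -> Prop) :
  P 1%g -> (forall x y, x \in A -> P y -> P (x * y)%g) ->
  forall x, x \in <<A>>%g -> P x.
Proof.
move=> P1 PM x; have [n ->] := gen_expgs A.
elim: n x => [|n IHn] x; first by rewrite expg0 => /set1P ->.
rewrite expgS => /mulsgP[a y + /IHn Py ->].
by rewrite !inE => /orP[/eqP-> | /PM]; [rewrite mul1g | apply].
Qed.

(** * Generators moving a given line of vectors or of traceless matrices *)

Section Stabilisers.
Variable F : finFieldType.
Local Notation gT := {'GL_2[F]}.
Implicit Types (x y : gT) (A : {set gT}).

Definition eigen x (v1 v2 l : F) :=
  (ea x * v1 + eb x * v2 == l * v1) && (ec x * v1 + ed x * v2 == l * v2).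

(** Otherwise all of SL_2 would preserve the line of the vector, but the two elementary unipotents
    have no common eigenvector. *)
Lemma moved_vector A v1 v2 : <<A>>%g = SL2 F -> (v1, v2) != (0, 0) ->
  exists2 a, a \in A & forall l, ~~ eigen a v1 v2 l.
Proof.
move=> genA v0.
case: (pickP [pred a in A | [forall l, ~~ eigen a v1 v2 l]]) => [a|none].
  by case/andP=> aA /forallP; exists a.
have eigA a : a \in A -> exists l, eigen a v1 v2 l.
  move=> aA; move: (none a); rewrite /= aA /= => /negbT.
  by rewrite negb_forall => /existsP[l]; rewrite negbK; exists l.
have eigG x : x \in SL2 F -> exists l, eigen x v1 v2 l.
  rewrite -genA; apply: (gen_mul_ind (P := fun x => exists l, eigen x v1 v2 l)) =>
    [|a y /eigA[l /andP[/eqP l1 /eqP l2]]].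
    by exists 1; rewrite /eigen !entries1; apply/andP; split; apply/eqP; ring.
  case=> m /andP[/eqP m1 /eqP m2]; exists (l * m); rewrite /eigen !mulE.
  apply/andP; split; apply/eqP.
  - by apply: (eq_comb3 (k1 := ea a) (k2 := eb a) (k3 := m) m1 m2 l1); ring.
  - by apply: (eq_comb3 (k1 := ec a) (k2 := ed a) (k3 := m) m1 m2 l2); ring.
have det12 : (1 : F) * 1 - 1 * 0 = 1 by ring.
have det21 : (1 : F) * 1 - 0 * 1 = 1 by ring.
case/negP: v0; rewrite xpair_eqE.
have [l] := eigG _ (mk_SL2 det12); rewrite /eigen !(mk_entries det12).
case/andP=> /eqP l1 /eqP l2.
have [m] := eigG _ (mk_SL2 det21); rewrite /eigen !(mk_entries det21).
case/andP=> /eqP m1 /eqP m2; apply/andP; split; rewrite -sqrf_eq0; apply/eqP.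
- by apply: (eq_comb2 (k1 := v1) (k2 := - v2) m2 m1); ring.
- by apply: (eq_comb2 (k1 := v2) (k2 := - v1) l1 l2); ring.
Qed.

(* [x m = l m x] for the traceless matrix [m = ((a, b), (c, - a))]. *)
Definition normalises x (a b c l : F) :=
  [&& ea x * a + eb x * c == l * (a * ea x + b * ec x),
      ea x * b - eb x * a == l * (a * eb x + b * ed x),
      ec x * a + ed x * c == l * (c * ea x - a * ec x) &
      ec x * b - ed x * a == l * (c * eb x - a * ed x)].

(** The same argument for conjugation on traceless matrices. Invertibility of 2 excludes the scalar
    matrices, which are traceless in characteristic 2. *)
Lemma moved_traceless A a b c :
  2%:R != 0 :> F -> <<A>>%g = SL2 F -> ~~ [&& a == 0, b == 0 & c == 0] ->
  exists2 h, h \in A & forall l, ~~ normalises h a b c l.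
Proof.
move=> two0 genA m0.
case: (pickP [pred h in A | [forall l, ~~ normalises h a b c l]]) => [h|none].
  by case/andP=> hA /forallP; exists h.
have normA h : h \in A -> exists l, normalises h a b c l.
  move=> hA; move: (none h); rewrite /= hA /= => /negbT.
  by rewrite negb_forall => /existsP[l]; rewrite negbK; exists l.
have normG x : x \in SL2 F -> exists l, normalises x a b c l.
  rewrite -genA; apply: (gen_mul_ind (P := fun x =>
    exists l, normalises x a b c l)) => [|h y /normA[l]].
    exists 1; rewrite /normalises !entries1.
    by apply/and4P; split; apply/eqP; ring.
  case/and4P=> /eqP l1 /eqP l2 /eqP l3 /eqP l4.
  case=> m /and4P[/eqP m1 /eqP m2 /eqP m3 /eqP m4].
  exists (l * m); rewrite /normalises !mulE; apply/and4P; split; apply/eqP.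
  - by apply: (eq_comb4 (k1 := ea h) (k2 := eb h) (k3 := m * ea y)
      (k4 := m * ec y) m1 m3 l1 l2); ring.
  - by apply: (eq_comb4 (k1 := ea h) (k2 := eb h) (k3 := m * eb y)
      (k4 := m * ed y) m2 m4 l1 l2); ring.
  - by apply: (eq_comb4 (k1 := ec h) (k2 := ed h) (k3 := m * ea y)
      (k4 := m * ec y) m1 m3 l3 l4); ring.
  - by apply: (eq_comb4 (k1 := ec h) (k2 := ed h) (k3 := m * eb y)
      (k4 := m * ed y) m2 m4 l3 l4); ring.
have det12 : (1 : F) * 1 - 1 * 0 = 1 by ring.
have det21 : (1 : F) * 1 - 0 * 1 = 1 by ring.
have [l] := normG _ (mk_SL2 det12); rewrite /normalises !(mk_entries det12).
case/and4P=> /eqP l1 /eqP l2 /eqP l3 /eqP l4.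
have [m] := normG _ (mk_SL2 det21); rewrite /normalises !(mk_entries det21).
case/and4P=> /eqP m1 /eqP m2 /eqP m3 /eqP m4.
have c0 : c = 0.
  apply/eqP; rewrite -sqrf_eq0; apply/eqP.
  by apply: (eq_comb2 (k1 := c) (k2 := - a) l1 l3); ring.
have b0 : b = 0.
  apply/eqP; rewrite -sqrf_eq0; apply/eqP.
  by apply: (eq_comb2 (k1 := b) (k2 := a) m4 m2); ring.
have a0 : a = 0.
  apply/eqP; rewrite -sqrf_eq0 -(mulrI_eq0 _ (mulfI two0)); apply/eqP.
  move: l1 l2; rewrite c0 b0 => l1 l2.
  by apply: (eq_comb2 (k1 := - a) (k2 := a) l2 l1); ring.
by case/negP: m0; rewrite a0 b0 c0 eqxx.
Qed.

End Stabilisers.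

(** * The order of SL_2 *)

Section Order.
Variable F : finFieldType.
Local Notation q := #|F|.
Local Open Scope nat_scope.

Lemma card_field_gt1 : 1 < q.
Proof. exact: card_finNzRing_gt1. Qed.

(** If [ea x] is nonzero the determinant yields [ed x], otherwise it yields [ec x]; hence the switch
    in the third coordinate. *)
Lemma card_SL2_le : #|SL2 F| <= q ^ 3.
Proof.
pose f (x : {'GL_2[F]}) := (ea x, eb x, if ea x == 0%R then ed x else ec x).
have inj : {in SL2 F &, injective f}.
  move=> x y /SL2_det + /SL2_det; rewrite /f.
  case: ifP => [/eqP ax|/negbT ax] + + [exy ebxy]; rewrite -exy -ebxy.
  - rewrite ax eqxx => d1 d2 ed_eq; apply: entriesP => //.
    have b0 : eb x != 0%R by apply: contra_eq_neq d1 => ->;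
      rewrite !mul0r subrr eq_sym oner_eq0.
    apply: (mulfI b0); apply: (eq_comb2 (k1 := 1%R) (k2 := (-1)%R) d2 d1); ring.
  - rewrite (negbTE ax) => d1 d2 ec_eq; apply: entriesP => //.
    apply: (mulfI ax); apply: (eq_comb3 (k1 := 1%R) (k2 := (-1)%R)
      (k3 := eb x) d1 d2 ec_eq); ring.
rewrite -(card_in_imset inj); apply: leq_trans (max_card _) _.
by rewrite !card_prod !expnS expn0 muln1 mulnA.
Qed.

(** Already the matrices with nonzero upper left entry number [(q - 1) * q ^ 2]. *)
Lemma card_SL2_ge : q ^ 3 <= 2 * #|SL2 F|.
Proof.
pose D := setX (setX [set~ (0%R : F)] [set: F]) [set: F].
pose f (u : F * F * F) := mk u.1.1 u.1.2 u.2 ((1 + u.1.2 * u.2) / u.1.1)%R.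
have det u : u \in D -> (u.1.1 * ((1 + u.1.2 * u.2) / u.1.1) - u.1.2 * u.2 = 1)%R.
  by rewrite !inE !andbT => u0; field.
have inj : {in D &, injective f}.
  move=> [[a b] c] [[a' b'] c'] uD vD eqf.
  have /= [[[e1 e2] e3] _] := mk_entries (det _ uD).
  have /= [[[e1' e2'] e3'] _] := mk_entries (det _ vD).
  move: eqf; rewrite /f /= => eqf; congr (_, _, _).
  - by rewrite -[LHS]e1 eqf e1'.
  - by rewrite -[LHS]e2 eqf e2'.
  - by rewrite -[LHS]e3 eqf e3'.
have sub : f @: D \subset SL2 F.
  by apply/subsetP => _ /imsetP[u uD ->]; apply: mk_SL2; apply: det.
have := subset_leq_card sub; rewrite card_in_imset // !cardsX !cardsT.
rewrite cardsC1 !expnS expn0; have := card_field_gt1; cnia.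
Qed.

Lemma card_SL2_ge4 : 4 <= #|SL2 F|.
Proof.
have le : 2 ^ 3 <= q ^ 3 by rewrite leq_exp2r ?card_field_gt1.
by move: (leq_trans le card_SL2_ge); rewrite -[2 ^ 3]/(2 * 4) leq_pmul2l.
Qed.

End Order.

(** * Eigenvectors *)

Local Open Scope ring_scope.

Section LarsenPink.
Variable F : finFieldType.
Local Notation gT := {'GL_2[F]}.
Implicit Types (x y : gT) (A H : {set gT}) (s : option F).

(** The bound drops to 1 when [a] vanishes; on the projective line this makes room for the point at
    infinity, which is then a root. *)
Lemma card_quadratic (a b c : F) : ~~ [&& a == 0, b == 0 & c == 0] ->
  (#|[set s : F | (a * s ^+ 2 + b * s + c == 0)%R]| <= 1 + (a != 0)%R)%N.
Proof.
move=> abc0; set R := [set s | _]; pose p : {poly F} := Poly [:: c; b; a].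
have pE (s : F) : p.[s] = a * s ^+ 2 + b * s + c by rewrite horner_Poly /=; ring.
have p0 : p != 0.
  apply: contraNneq abc0 => p0.
  have coef i : p`_i = 0 by rewrite p0 coef0.
  have := (coef 2, coef 1, coef 0)%N; rewrite !coef_Poly /= => -[[-> ->] ->].
  by rewrite eqxx.
have szp : (size p <= 2 + (a != 0)%R)%N.
  case: eqVneq => [a0|_]; last exact: size_Poly.
  by apply/leq_sizeP => -[|[|[|j]]] //; rewrite coef_Poly /= ?a0 // nth_default.
have := max_poly_roots p0 (rs := enum R); rewrite enum_uniq -cardE => lt.
rewrite -ltnS; apply: leq_trans (lt _ isT) szp.
by apply/allP => s; rewrite mem_enum inE /root pE.
Qed.

(** Representatives of the points of the projective line, [None] being the point at infinity. *)
Definition pv s : F * F := if s is Some u then (1, u) else (0, 1).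

Lemma pv_neq0 s : pv s != (0, 0).
Proof. by case: s => [u|]; rewrite xpair_eqE oner_eq0 ?andbF. Qed.

(* [vfix x v = 0] says that [v] is an eigenvector of [x]; up to sign it is the
   trace of [x * n] where [n] is the nilpotent matrix with image spanned by
   [v]. *)
Definition vfix x (v : F * F) :=
  ec x * v.1 ^+ 2 + (ed x - ea x) * v.1 * v.2 - eb x * v.2 ^+ 2.

(** [vfix x v] is the determinant of the pair formed by [v] and its image under [x]. *)
Lemma vfix_eigen x v : v != (0, 0) -> vfix x v = 0 ->
  exists l, eigen x v.1 v.2 l.
Proof.
case: v => v1 v2 /=; rewrite xpair_eqE negb_and /vfix /= => v0 fix0.
have [v10|v10] := eqVneq v1 0.
  rewrite v10 eqxx /= in v0; exists (ed x); rewrite /eigen v10.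
  have b0 : eb x = 0.
    apply/eqP; have := mulf_eq0 (eb x) (v2 ^+ 2);
      rewrite sqrf_eq0 (negbTE v0) orbF => <-.
    by apply/eqP; apply: (eq_comb1 (k1 := -1) fix0); rewrite v10; ring.
  by rewrite b0; apply/andP; split; apply/eqP; ring.
exists ((ea x * v1 + eb x * v2) / v1); rewrite /eigen; apply/andP; split; apply/eqP.
  by field.
apply: (mulfI v10); apply: (eq_comb1 (k1 := 1) fix0); by field.
Qed.

Lemma eigen_charpoly x v l : x \in SL2 F -> v != (0, 0) -> eigen x v.1 v.2 l ->
  1 * l ^+ 2 + (- tr x) * l + 1 = 0.
Proof.
move=> /SL2_det det; case: v => v1 v2 /=; rewrite xpair_eqE negb_and => v0.
case/andP=> /eqP e1 /eqP e2; rewrite /tr.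
case/orP: v0 => v0; apply: (mulfI v0).
- by apply: (eq_comb3 (k1 := ed x - l) (k2 := - eb x) (k3 := - v1) e1 e2 det); ring.
- by apply: (eq_comb3 (k1 := ea x - l) (k2 := - ec x) (k3 := - v2) e2 e1 det); ring.
Qed.

Lemma eigen_quotient x y v1 v2 l : x \in SL2 F -> y \in SL2 F ->
  eigen x v1 v2 l -> eigen y v1 v2 l -> eigen (y^-1 * x)%g v1 v2 1.
Proof.
move=> xG yG /andP[/eqP x1 /eqP x2] /andP[/eqP y1 /eqP y2].
have det := SL2_det yG; rewrite /eigen !mulE !(entriesV yG).
apply/andP; split; apply/eqP.
- transitivity (l * (ed y * v1 - eb y * v2)).
    by apply: (eq_comb2 (k1 := ed y) (k2 := - eb y) x1 x2); ring.
  by apply: (eq_comb3 (k1 := - ed y) (k2 := eb y) (k3 := v1) y1 y2 det); ring.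
- transitivity (l * (- ec y * v1 + ea y * v2)).
    by apply: (eq_comb2 (k1 := - ec y) (k2 := ea y) x1 x2); ring.
  by apply: (eq_comb3 (k1 := ec y) (k2 := - ea y) (k3 := v2) y1 y2 det); ring.
Qed.

(** [w] fixes both [v] and its image under [a], and these form a basis because [a] moves the line of
    [v]. *)
Lemma fixes_two_vectors w a v1 v2 : a \in SL2 F -> (v1, v2) != (0, 0) ->
  (forall l, ~~ eigen a v1 v2 l) ->
  eigen w v1 v2 1 -> eigen (w ^ a)%g v1 v2 1 -> w = 1%g.
Proof.
move=> aG v0 moved /andP[/eqP w1 /eqP w2].
pose u1 := ea a * v1 + eb a * v2; pose u2 := ec a * v1 + ed a * v2.
have D0 : v1 * u2 - v2 * u1 != 0.
  apply: contraTneq isT => D0; have [|l] := @vfix_eigen a (v1, v2) v0.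
    by rewrite /vfix /= -D0 /u1 /u2; ring.
  by move=> eig; have := moved l; rewrite eig.
have det := SL2_det aG; rewrite conjgE /eigen !mulE !(entriesV aG).
case/andP=> /eqP c1 /eqP c2.
have wu1 : ea w * u1 + eb w * u2 = u1.
  apply: (eq_comb3 (k1 := ea a) (k2 := eb a) (k3 := -
    (ea w * u1 + eb w * u2)) c1 c2 det).
  by rewrite /u1 /u2; ring.
have wu2 : ec w * u1 + ed w * u2 = u2.
  apply: (eq_comb3 (k1 := ec a) (k2 := ed a) (k3 := -
    (ec w * u1 + ed w * u2)) c1 c2 det).
  by rewrite /u1 /u2; ring.
apply: entriesP; rewrite entries1; apply: (mulIf D0).
- by apply: (eq_comb2 (k1 := u2) (k2 := - v2) w1 wu1); ring.
- by apply: (eq_comb2 (k1 := v1) (k2 := - u1) wu1 w1); ring.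
- by apply: (eq_comb2 (k1 := u2) (k2 := - v2) w2 wu2); ring.
- by apply: (eq_comb2 (k1 := v1) (k2 := - u1) wu2 w2); ring.
Qed.

(** For a generator [a] moving the line, [(x, y) |-> x * a * y^-1] is injective on pairs: in a
    collision [x'^-1 * x] and its conjugate by [a] both fix the vector, so [fixes_two_vectors]
    applies. *)
Lemma card_eigen H v1 v2 l :
  H^-1%g = H -> <<H>>%g = SL2 F -> (v1, v2) != (0, 0) ->
  (#|[set x in H | eigen x v1 v2 l]| ^ 2 <= #|H ^+ 3|%g)%N.
Proof.
move=> HV genH v0; set X := [set _ in _ | _].
have sHG : H \subset SL2 F by rewrite -genH subset_gen.
have [a aH moved] := moved_vector genH v0.
pose f (u : gT * gT) : gT := (u.1 * (a * u.2^-1))%g.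
have inj : {in setX X X &, injective f}.
  move=> [x y] [x' y'] /setXP[+ +] /setXP[]; rewrite /= !inE.
  move=> /andP[xH ex] /andP[yH ey] /andP[xH' ex'] /andP[yH' ey'] eqf.
  have eqw : ((x'^-1 * x) ^ a = y'^-1 * y)%g.
    rewrite conjgE; apply: (mulIg y^-1%g); rewrite mulgK -!mulgA.
    by move: eqf; rewrite /f /= => ->; rewrite !mulKg.
  have ex1 := eigen_quotient (subsetP sHG _ xH) (subsetP sHG _ xH') ex ex'.
  have ey1 := eigen_quotient (subsetP sHG _ yH) (subsetP sHG _ yH') ey ey'.
  have w1 : (x'^-1 * x)%g = 1%g.
    by apply: (fixes_two_vectors (subsetP sHG _ aH) v0 moved); rewrite ?eqw.
  have yy : y = y' by apply: (mulgI y'^-1%g); rewrite -eqw w1 conj1g mulVg.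
  by rewrite yy; congr (_, _); apply: (mulgI x'^-1%g); rewrite w1 mulVg.
rewrite expnS expn1 -cardsX -(card_in_imset inj); apply: subset_leq_card.
apply/subsetP => _ /imsetP[[x y] /setXP[/= + +] ->];
  rewrite !inE => /andP[xH _] /andP[yH _].
by rewrite !expgS expg0 mulg1 mem_mulg // mem_mulg // -HV memV_invg.
Qed.

(** Since [x] is invertible, this means that [x] and [y] share an eigenline over [F]. *)
Definition linked x y := [exists s,
  (vfix x (pv s) == 0) && (vfix (x * y)%g (pv s) == 0)].

Lemma card_fixed_points x : nonscalar x ->
  (#|[set s | vfix x (pv s) == 0%R]| <= 2)%N.
Proof.
move=> nsx; set E := [set s | _];
  pose R := [set u : F | - eb x * u ^+ 2 + (ed x - ea x) * u + ec x == 0].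
have leR : (#|R| <= 1 + (eb x != 0)%R)%N.
  rewrite -[eb x == 0]oppr_eq0; apply: card_quadratic.
  by move: nsx; rewrite /nonscalar oppr_eq0 subr_eq0 [ed x == _]eq_sym [(ec x == 0)
    && _]andbC.
have sub : E \subset [set Some u | u in R] :|: (if eb x == 0 then [set None] else set0).
  apply/subsetP => -[u|]; rewrite !inE /vfix /=.
    move=> e; apply/orP; left; apply: imset_f; rewrite inE.
    by move: e; congr (_ == _); ring.
  rewrite expr0n expr1n !mulr0 !mul0r !add0r mulr1 oppr_eq0 => ->.
  by rewrite inE eqxx orbT.
apply: leq_trans (subset_leq_card sub) _; apply: leq_trans (leq_card_setU _ _) _.
have := leq_imset_card Some R; move: leR; case: eqP => _; rewrite ?cards1 ?cards0 /=;
  clia.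
Qed.

(** [y] shares one of the at most two eigenlines of [x], and its eigenvalue there is one of the at
    most two roots of the characteristic polynomial for trace [t]. *)
Lemma card_linked H x t L : x \in SL2 F -> H \subset SL2 F -> nonscalar x ->
  (forall s l, #|[set y in H | eigen y (pv s).1 (pv s).2 l]| <= L)%N ->
  (#|[set y in H | (tr y == t) && linked x y]| <= 4 * L)%N.
Proof.
move=> xG sHG nsx leL.
pose E := [set s | vfix x (pv s) == 0].
pose R := [set l : F | 1 * l ^+ 2 + (- t) * l + 1 == 0].
have leE : (#|E| <= 2)%N := card_fixed_points nsx.
have leR : (#|R| <= 2)%N.
  by have := @card_quadratic 1 (- t) 1; rewrite oner_eq0; apply.
set D := [set _ in _ | _].
have sub : D \subset \bigcup_(u in setX E R) [set y in H | eigen y (pv u.1).1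
  (pv u.1).2 u.2].
  apply/subsetP => y; rewrite inE =>
    /and3P[yH /eqP try /existsP[s /andP[/eqP fx /eqP fxy]]].
  have yG := subsetP sHG _ yH.
  have v0 := pv_neq0 s.
  have [m em] := vfix_eigen v0 fx; have mchar := eigen_charpoly xG v0 em.
  have fy : vfix y (pv s) = 0.
    (* [tr x - m] is the other eigenvalue of [x], the inverse of [m]. *)
    have m0 : tr x - m != 0.
      by apply: contraTneq isT => m0; move/eqP: mchar;
        rewrite (_ : _ + 1 = 1 - m * (tr x - m));
        [rewrite m0 mulr0 subr0 oner_eq0 | ring].
    apply: (mulfI m0); case/andP: em => /eqP e1 /eqP e2.
    move: fxy; rewrite /vfix !mulE /tr;
      move: (pv s).1 (pv s).2 e1 e2 => v1 v2 e1 e2 fxy.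
    by apply: (eq_comb3 (k1 := 1) (k2 := - (ea y * v1 + eb y * v2))
      (k3 := ec y * v1 + ed y * v2) fxy e2 e1); ring.
  have [l el] := vfix_eigen v0 fy; have lchar := eigen_charpoly yG v0 el.
  apply/bigcupP; exists (s, l); last by rewrite inE yH.
  by rewrite !inE /= fx -try lchar !eqxx.
apply: leq_trans (subset_leq_card sub) _.
apply: leq_trans (_ : (\sum_(u in setX E R) L <= _)%N).
  elim/big_rec2: _ => [|u m X _ le]; first by rewrite cards0.
  by apply: leq_trans (leq_card_setU _ _) _; rewrite leq_add.
by rewrite sum_nat_const cardsX leq_mul2r; rewrite (leq_mul leE leR) orbT.
Qed.

End LarsenPink.

(** * Fibres of the product map on a trace class *)

Local Open Scope ring_scope.

Section Fibres.
Variable F : finFieldType.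
Local Notation gT := {'GL_2[F]}.
Implicit Types (x y : gT) (A H : {set gT}) (s : option F).

(* The trace of the product of [x] with the traceless matrix
   [((a, b), (c, - a))]. *)
Definition trm x (a b c : F) := ea x * a + eb x * c + ec x * b - ed x * a.

(** A nonzero nilpotent matrix is a multiple of the rank one matrix attached to a point [s] of the
    projective line, and the trace pairing with it is a multiple of [vfix] at [s]. *)
Lemma linkedI x y a b c : ~~ [&& a == 0, b == 0 & c == 0] ->
  a ^+ 2 + b * c = 0 -> trm x a b c = 0 -> trm (x * y)%g a b c = 0 -> linked x y.
Proof.
move=> m0 nil tx txy.
have [s [k [k0 ka kb kc]]] : exists s k, [/\ k != 0,
    a = - k * (pv s).1 * (pv s).2, b = k * (pv s).1 ^+ 2 & c = - k * (pv s).2 ^+ 2].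
  have [b0|b0] := eqVneq b 0.
    have a0 : a = 0 by apply/eqP; rewrite -sqrf_eq0 -nil b0 mul0r addr0.
    exists None, (- c); rewrite oppr_eq0; split; rewrite /= ?a0 ?b0; try ring.
    by apply: contraNneq m0 => ->; rewrite a0 b0 eqxx.
  exists (Some (- a / b)), b; split => //=; [by field | by ring |].
  by apply: (mulfI b0); apply: (eq_comb1 (k1 := 1) nil); field.
have trmE z : trm z a b c = k * vfix z (pv s).
  by rewrite /trm /vfix ka kb kc; ring.
have fixed z : trm z a b c = 0 -> vfix z (pv s) = 0.
  by rewrite trmE => /eqP; rewrite mulf_eq0 (negbTE k0) => /eqP.
by apply/existsP; exists s; rewrite !fixed ?eqxx.
Qed.

Lemma parallel_trans (f1 f2 f3 g1 g2 g3 w1 w2 w3 : F) : w1 != 0 ->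
  f1 * w2 = f2 * w1 -> f1 * w3 = f3 * w1 ->
  g1 * w2 = g2 * w1 -> g1 * w3 = g3 * w1 ->
  [/\ f1 * g2 = g1 * f2, f2 * g3 = g2 * f3 & f1 * g3 = g1 * f3].
Proof.
move=> w0 e12 e13 h12 h13; split; apply: (mulfI w0).
- by apply: (eq_comb2 (k1 := - f1) (k2 := g1) h12 e12); ring.
- apply: (mulfI w0).
  by apply: (eq_comb4 (k1 := - g3 * w1) (k2 := - f1 * w2) (k3 := f1 * w3)
    (k4 := g2 * w1) e12 h13 h12 e13); ring.
- by apply: (eq_comb2 (k1 := - f1) (k2 := g1) h13 e13); ring.
Qed.

(** Let [w] be the cross product of [(a, b, c)] and [(a', b', c')]. If it vanishes these two are
    parallel; otherwise [f] and [g] are both multiples of [w]. *)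
Lemma cross_orthogonal (f1 f2 f3 g1 g2 g3 a b c a' b' c' : F) :
  f1 * a + f2 * b + f3 * c = 0 -> f1 * a' + f2 * b' + f3 * c' = 0 ->
  g1 * a + g2 * b + g3 * c = 0 -> g1 * a' + g2 * b' + g3 * c' = 0 ->
  [/\ a * b' = a' * b, b * c' = b' * c & a * c' = a' * c] \/
  [/\ f1 * g2 = g1 * f2, f2 * g3 = g2 * f3 & f1 * g3 = g1 * f3].
Proof.
move=> fn fn' gn gn'.
pose w1 := b * c' - b' * c; pose w2 := a' * c - a * c'; pose w3 := a * b' - a' * b.
have par (h1 h2 h3 : F) :
    h1 * a + h2 * b + h3 * c = 0 -> h1 * a' + h2 * b' + h3 * c' = 0 ->
    [/\ h1 * w2 = h2 * w1, h2 * w3 = h3 * w2 & h1 * w3 = h3 * w1].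
  move=> hn hn'; split.
  - by apply: (eq_comb2 (k1 := - c') (k2 := c) hn hn'); rewrite /w1 /w2; ring.
  - by apply: (eq_comb2 (k1 := - a') (k2 := a) hn hn'); rewrite /w3 /w2; ring.
  - by apply: (eq_comb2 (k1 := b') (k2 := - b) hn hn'); rewrite /w1 /w3; ring.
have [e12 e23 e13] := par _ _ _ fn fn'; have [h12 h23 h13] := par _ _ _ gn gn'.
have [w10|w10] := eqVneq w1 0; last by right; apply: parallel_trans w10 e12 e13 h12 h13.
have [w20|w20] := eqVneq w2 0; last first.
  right; have [? ? ?] := parallel_trans w20 e23 (esym e12) h23 (esym h12).
  by split=> //; rewrite mulrC [RHS]mulrC.
have [w30|w30] := eqVneq w3 0; last first.
  right; have [? ? ?] := parallel_trans w30 (esym e13) (esym e23) (esym h13) (esym h23).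
  by split=> //; rewrite mulrC [RHS]mulrC.
by left; split; [apply: subr0_eq | apply: subr0_eq | apply/esym/subr0_eq].
Qed.

Lemma trVM x y : x \in SL2 F ->
  tr (x^-1 * y)%g = ed x * ea y - eb x * ec y - ec x * eb y + ea x * ed y.
Proof. by move=> xG; rewrite /tr !mulE !(entriesV xG); ring. Qed.

(* [x], [x'], [x''] lie on the intersection of a quadric with an affine space cut
   out by three linear equations.  If these are independent this is a line, and
   a line meeting the quadric three times has a nilpotent direction; otherwise
   [y1] is unipotent. *)
Lemma three_points_linked t x x' x'' y1 y2 : t != 0 ->
  x \in SL2 F -> x' \in SL2 F -> x'' \in SL2 F -> y1 \in SL2 F -> y2 \in SL2 F ->
  tr x = t -> tr x' = t -> tr x'' = t ->
  tr (x^-1 * y1)%g = t -> tr (x'^-1 * y1)%g = t -> tr (x''^-1 * y1)%g = t ->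
  tr (x^-1 * y2)%g = t -> tr (x'^-1 * y2)%g = t -> tr (x''^-1 * y2)%g = t ->
  x' != x -> x'' != x -> x'' != x' ->
  y1 != 1%g -> y2 != 1%g -> y2 != y1 ->
  linked x (x^-1 * y1)%g.
Proof.
move=> t0 xG x'G x''G y1G y2G tx tx' tx''.
rewrite !trVM // => ty1 ty1' ty1'' ty2 ty2' ty2'' nx' nx'' nx''' ny1 ny2 ny21.
have dx := SL2_det xG; have dx' := SL2_det x'G; have dx'' := SL2_det x''G.
have dy1 := SL2_det y1G; have dy2 := SL2_det y2G.
pose a := ea x' - ea x; pose b := eb x' - eb x; pose c := ec x' - ec x.
pose a' := ea x'' - ea x; pose b' := eb x'' - eb x; pose c' := ec x'' - ec x.
have da : ed x' = ed x - a.
  by rewrite /a; apply: (eq_comb2 (k1 := 1) (k2 := -1) tx' tx); rewrite /tr; ring.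
have da' : ed x'' = ed x - a'.
  by rewrite /a'; apply: (eq_comb2 (k1 := 1) (k2 := -1) tx'' tx); rewrite /tr; ring.
have ex' : [/\ ea x' = ea x + a, eb x' = eb x + b & ec x' = ec x + c].
  by rewrite /a /b /c; split; ring.
have ex'' : [/\ ea x'' = ea x + a', eb x'' = eb x + b' & ec x'' = ec x + c'].
  by rewrite /a' /b' /c'; split; ring.
have n0 : ~~ [&& a == 0, b == 0 & c == 0].
  apply: contraNN nx' => /and3P[/eqP a0 /eqP b0 /eqP c0].
  by case: ex' => ea' eb' ec'; apply/eqP/entriesP;
    rewrite ?ea' ?eb' ?ec' ?da ?a0 ?b0 ?c0 ?addr0 ?subr0.
have n0' : ~~ [&& a' == 0, b' == 0 & c' == 0].
  apply: contraNN nx'' => /and3P[/eqP a0 /eqP b0 /eqP c0].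
  by case: ex'' => ea' eb' ec'; apply/eqP/entriesP;
    rewrite ?ea' ?eb' ?ec' ?da' ?a0 ?b0 ?c0 ?addr0 ?subr0.
have nn : ~~ [&& a' == a, b' == b & c' == c].
  apply: contraNN nx''' => /and3P[/eqP a0 /eqP b0 /eqP c0].
  case: ex' ex'' => ea' eb' ec' [ea'' eb'' ec'']; apply/eqP/entriesP;
  by rewrite ?ea' ?eb' ?ec' ?ea'' ?eb'' ?ec'' ?da ?da' ?a0 ?b0 ?c0.
case: ex' => ea' eb' ec'; case: ex'' => ea'' eb'' ec''.
move: ty1' ty2' dx'; rewrite da ea' eb' ec' => ty1' ty2' dx'.
move: ty1'' ty2'' dx''; rewrite da' ea'' eb'' ec'' => ty1'' ty2'' dx''.
have f1n : (ea y1 - ed y1) * a + ec y1 * b + eb y1 * c = 0.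
  by apply: (eq_comb2 (k1 := 1) (k2 := -1) ty1 ty1'); ring.
have f1n' : (ea y1 - ed y1) * a' + ec y1 * b' + eb y1 * c' = 0.
  by apply: (eq_comb2 (k1 := 1) (k2 := -1) ty1 ty1''); ring.
have f2n : (ea y2 - ed y2) * a + ec y2 * b + eb y2 * c = 0.
  by apply: (eq_comb2 (k1 := 1) (k2 := -1) ty2 ty2'); ring.
have f2n' : (ea y2 - ed y2) * a' + ec y2 * b' + eb y2 * c' = 0.
  by apply: (eq_comb2 (k1 := 1) (k2 := -1) ty2 ty2''); ring.
have tm : trm x a b c = - (a ^+ 2 + b * c).
  by rewrite /trm; apply: (eq_comb2 (k1 := 1) (k2 := -1) dx dx'); ring.
have tm' : trm x a' b' c' = - (a' ^+ 2 + b' * c').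
  by rewrite /trm; apply: (eq_comb2 (k1 := 1) (k2 := -1) dx dx''); ring.
case: (cross_orthogonal f1n f1n' f2n f2n') => -[].
  move=> ab bc ac.
  have [s [sa sb sc]] := proportional n0 ab bc ac.
  have s0 : s != 0.
    by apply: contraNneq n0' => s0; rewrite sa sb sc s0 !mul0r eqxx.
  have s1 : 1 - s != 0.
    apply: contraNneq nn => s1; have {}s1 : s = 1 by apply/esym/subr0_eq.
    by rewrite sa sb sc s1 !mul1r !eqxx.
  (* Along the line from [x] in the direction [(a, b, c)] the determinant is 1 at the parameters 0,
     1 and [s], so its quadratic coefficient vanishes. *)
  have nil : a ^+ 2 + b * c = 0.
    apply: (mulfI s0); apply: (mulfI s1); move: tm'; rewrite sa sb sc => tm'.
    by apply: (eq_comb2 (k1 := s) (k2 := -1) tm tm'); rewrite /trm; ring.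
  apply: (linkedI n0 nil); first by rewrite tm nil oppr0.
  rewrite mulKVg -f1n /trm; ring.
move=> fg12 fg23 fg13.
have f0 : ~~ [&& ea y1 - ed y1 == 0, ec y1 == 0 & eb y1 == 0].
  apply: contraNN ny1 => /and3P[ad /eqP c0 /eqP b0].
  have {}ad : ea y1 = ed y1 by apply/eqP; rewrite -subr_eq0.
  have a1 : ed y1 = 1.
    apply: (mulfI t0); move: ty1; rewrite ad c0 b0 => ty1.
    by apply: (eq_comb2 (k1 := 1) (k2 := - ed y1) ty1 tx); rewrite /tr; ring.
  by apply/eqP/entriesP; rewrite !entries1 ?b0 ?c0 ?ad.
have [k [ka kc kb]] := proportional f0 fg12 fg23 fg13.
(* The traceless parts being proportional, [y2 = l + k * y1]. The trace conditions give [l = 1 - k],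
   and the determinants then force [tr y1 = 2]. *)
pose l := ea y2 - k * ea y1.
have ea2 : ea y2 = l + k * ea y1 by rewrite /l; ring.
have ed2 : ed y2 = l + k * ed y1.
  by rewrite /l; apply: (eq_comb1 (k1 := -1) ka); ring.
have lk : l = 1 - k.
  apply: (mulfI t0); move: ty2; rewrite ea2 ed2 kb kc => ty2.
  by apply: (eq_comb3 (k1 := 1) (k2 := - k) (k3 := - l) ty2 ty1 tx); rewrite /tr; ring.
have k0 : k != 0.
  apply: contraNneq ny2 => k0; apply/eqP/entriesP;
  by rewrite !entries1 ?ea2 ?ed2 ?kb ?kc ?lk ?k0 ?mul0r ?addr0 ?subr0.
have k1 : 1 - k != 0.
  apply: contraNneq ny21 => k1; have {}k1 : k = 1 by apply/esym/subr0_eq.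
  by apply/eqP/entriesP; rewrite ?ea2 ?ed2 ?kb ?kc ?lk ?k1 ?mul1r ?subrr ?add0r.
have t2 : ea y1 + ed y1 = 2%:R.
  apply: (mulfI k0); apply: (mulfI k1); move: dy2; rewrite ea2 ed2 kb kc lk => dy2.
  by apply: (eq_comb2 (k1 := 1) (k2 := - k ^+ 2) dy2 dy1); ring.
(* [u], [v], [w] and [- u] are the entries of [x^-1 * (y1 - 1)], which is nilpotent as [y1] is
   unipotent and the trace vanishes. *)
pose u := ed x * (ea y1 - 1) - eb x * ec y1.
pose v := ed x * eb y1 - eb x * (ed y1 - 1).
pose w := - ec x * (ea y1 - 1) + ea x * ec y1.
have u' : - ec x * eb y1 + ea x * (ed y1 - 1) = - u.
  by rewrite /u; apply: (eq_comb2 (k1 := 1) (k2 := -1) ty1 tx); rewrite /tr; ring.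
have m0 : ~~ [&& u == 0, v == 0 & w == 0].
  apply: contraNN ny1 => /and3P[/eqP u0 /eqP v0 /eqP w0].
  move: u'; rewrite u0 oppr0 => u'; apply/eqP/entriesP; rewrite !entries1.
  - by apply: (eq_comb3 (k1 := ea x) (k2 := eb x) (k3 := - (ea y1 - 1)) u0 w0 dx);
      rewrite /u /w; ring.
  - by apply: (eq_comb3 (k1 := ea x) (k2 := eb x) (k3 := - eb y1) v0 u' dx);
      rewrite /v; ring.
  - by apply: (eq_comb3 (k1 := ec x) (k2 := ed x) (k3 := - ec y1) u0 w0 dx);
      rewrite /u /w; ring.
  - by apply: (eq_comb3 (k1 := ec x) (k2 := ed x) (k3 := - (ed y1 - 1)) v0 u' dx);
      rewrite /v; ring.
have dy1' : (ea y1 - 1) * (ed y1 - 1) - eb y1 * ec y1 = 0.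
  by apply: (eq_comb2 (k1 := 1) (k2 := -1) dy1 t2); ring.
apply: (linkedI m0).
- by apply: (eq_comb2 (k1 := u) (k2 := - (ea x * ed x - eb x * ec x)) u' dy1');
    rewrite /u /v /w; ring.
- by rewrite /trm; apply: (eq_comb2 (k1 := - ed x)
    (k2 := ea x * ed x - eb x * ec x) u' t2);
  rewrite /u /v /w; ring.
- rewrite mulKVg /trm; have ttx := etrans ty1 (esym tx); rewrite /tr in ttx.
  apply: (eq_comb4 (k1 := - ed y1)
    (k2 := ed x * ea y1 - eb x * ec y1 - ec x * eb y1 + ea x * ed y1)
    (k3 := - (ea x + ed x)) (k4 := 1) u' t2 dy1 ttx).
  by rewrite /u /v /w; ring.
Qed.

End Fibres.

(** * The Larsen-Pink inequality for trace classes *)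

Local Open Scope nat_scope.

Section TraceSlice.
Variable F : finFieldType.
Local Notation gT := {'GL_2[F]}.
Variables (H : {set gT}) (t : F).
Hypotheses (H1 : 1%g \in H) (HV : H^-1%g = H) (genH : <<H>>%g = SL2 F).
Hypotheses (t0 : (t != 0)%R) (t4 : (t ^+ 2 != 4%:R)%R).

Let B := [set x in H | tr x == t].

Let sHG : H \subset SL2 F.
Proof. by rewrite -genH subset_gen. Qed.

Let BP x : x \in B -> [/\ x \in H, x \in SL2 F & tr x = t].
Proof. by rewrite inE => /andP[xH /eqP]; split=> //; apply: (subsetP sHG). Qed.

Let B_nonscalar x : x \in B -> nonscalar x.
Proof. by case/BP=> _ xG tx; apply: regular_nonscalar; rewrite // /regular tx t0. Qed.

Let generic (u : gT * gT * gT) :=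
  [&& ~~ linked u.1.1 u.1.2, u.1.2 != u.1.1^-1%g, u.2 != u.1.1^-1%g & u.2 != u.1.2].

Let T := [set u in setX (setX B B) B | generic u].

(** Three triples in one fibre over [(y1, y2)] would have distinct first entries satisfying
    [three_points_linked], and its conclusion contradicts [generic]. *)
Let card_generic : #|T| <= 2 * #|H ^+ 2|%g ^ 2.
Proof.
rewrite expnS expn1 -cardsX.
apply: (@card_le_fibers _ _ (fun u : gT * gT * gT =>
  (u.1.1 * u.1.2, u.1.1 * u.2)%g) _ _ _ _ _).
  move=> [[x1 x2] x3]; rewrite inE => /andP[/setXP[/setXP[/= + +] +] _].
  move=> /BP[x1H _ _] /BP[x2H _ _] /BP[x3H _ _].
  by rewrite inE /= !expgS expg0 mulg1 !mem_mulg.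
move=> [y1 y2] _; rewrite leqNgt; apply/negP => /card_gt2P[u [u' [u'']]].
set S := [set _ in _ | _].
have SP v : v \in S -> [/\ v.1.1 \in B, v.1.2 \in B, v.2 \in B & generic v] /\
    v = (v.1.1, v.1.1^-1 * y1, v.1.1^-1 * y2)%g.
  case: v => [[x1 x2] x3]; rewrite !inE /= => /andP[/andP[/andP[/andP[-> ->] ->] ->]].
  by case/eqP=> <- <-; rewrite !mulKg.
case=> -[/SP[[x1B x2B x3B gen] eu] /SP[[x1B' x2B' x3B' _] eu'] /SP[[x1B'' x2B'' x3B''
  _] eu'']].
case=> uu' u'u'' u''u.
move: x1B x2B x3B gen uu' u''u; rewrite eu /=.
move: x1B' x2B' x3B' u'u''; rewrite eu' /=.
move: x1B'' x2B'' x3B''; rewrite eu'' /=.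
clear eu eu' eu''.
move: u.1.1 u'.1.1 u''.1.1 => x x' x''.
move=> /BP[_ xG'' tx''] /BP[_ _ ty1''] /BP[_ _ ty2''].
move=> /BP[_ xG' tx'] /BP[_ _ ty1'] /BP[_ _ ty2'] ne'''.
move=> /BP[_ xG tx] /BP[_ y1G ty1] /BP[_ y2G ty2].
case/and4P=> /= /negP nl n21 n31 n32 ne' ne''.
apply: nl; apply: (three_points_linked t0 xG xG' xG'' _ _ tx tx' tx'' ty1 ty1' ty1''
  ty2 ty2' ty2'').
- by rewrite -(mulKVg x y1) groupM.
- by rewrite -(mulKVg x y2) groupM.
- by apply: contraNneq ne' => ->.
- by apply: contraNneq ne'' => ->.
- by apply: contraNneq ne''' => ->.
- by apply: contraNneq n21 => ->; rewrite mulg1.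
- by apply: contraNneq n31 => ->; rewrite mulg1.
- by apply: contraNneq n32 => ->.
Qed.

Let line_bound : exists2 L, L ^ 2 <= #|H ^+ 3|%g &
  forall s l, #|[set y in H | eigen y (pv s).1 (pv s).2 l]| <= L.
Proof.
pose X (u : option F * F) := [set y in H | eigen y (pv u.1).1 (pv u.1).2 u.2].
have [u _ maxX] := @arg_maxnP _ (None, 0%R) xpredT (fun u => #|X u|) isT.
exists #|X u| => [|s l]; last exact: (maxX (s, l)).
by apply: card_eigen => //; have := pv_neq0 u.1; case: (pv u.1).
Qed.

(** For given [x1], [x3] at most [4 * L + 1] choices of [x2] are bad; for given [x1], [x2] at most 2
    choices of [x3] are. *)
Let card_not_generic L :
  (forall s l, #|[set y in H | eigen y (pv s).1 (pv s).2 l]| <= L) ->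
  #|B| ^ 3 <= #|T| + (4 * L + 3) * #|B| ^ 2.
Proof.
move=> leL.
pose D1 := [set u in setX (setX B B) B | linked u.1.1 u.1.2 || (u.1.2 == u.1.1^-1%g)].
pose D2 := [set u in setX (setX B B) B | (u.2 == u.1.1^-1%g) || (u.2 == u.1.2)].
have card3 : #|setX (setX B B) B| = #|B| ^ 3 by rewrite !cardsX !expnS expn0 muln1
  mulnA.
have cover : #|B| ^ 3 <= #|T| + (#|D1| + #|D2|).
  rewrite -card3; apply: leq_trans (_ : #|T :|: (D1 :|: D2)| <= _).
    apply: subset_leq_card; apply/subsetP => u uB.
    move: uB; rewrite !inE => -> /=; rewrite /generic.
    case: linked; case: eqP => _; case: eqP => _; by case: eqP.
  apply: leq_trans (leq_card_setU _ _) _; rewrite leq_add2l.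
  exact: leq_card_setU.
have le1 : #|D1| <= (4 * L + 1) * #|B| ^ 2.
  rewrite expnS expn1 -cardsX.
  apply: (@card_le_fibers _ _ (fun u : gT * gT * gT => (u.1.1, u.2)) _ _ _ _ _).
    by move=> [[x1 x2] x3]; rewrite !inE /= => /andP[/andP[/andP[-> _] ->] _].
  move=> [x1 x3] /setXP[/= x1B _]; set S := [set _ in _ | _].
  have [x1H x1G _] := BP x1B.
  have inj : {in S &, injective (fun u : gT * gT * gT => u.1.2)}.
    move=> [[a b] c] [[a' b'] c']; rewrite !inE /=.
    by move=> /andP[_ /eqP[-> ->]] /andP[_ /eqP[-> ->]] ->.
  rewrite -(card_in_imset inj).
  apply: leq_trans (_ : #|[set y in H |
    (tr y == t) && linked x1 y] :|: [set x1^-1%g]| <= _).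
    apply: subset_leq_card; apply/subsetP => _ /imsetP[[[a b] c] + ->].
    rewrite !inE /= => /andP[/andP[/andP[/andP[_ /andP[-> ->]] _] ab] /eqP[<- _]].
    exact: ab.
  apply: leq_trans (leq_card_setU _ _) _; rewrite cards1 leq_add2r.
  by apply: card_linked => //; apply: B_nonscalar.
have le2 : #|D2| <= 2 * #|B| ^ 2.
  rewrite expnS expn1 -cardsX.
  apply: (@card_le_fibers _ _ (fun u : gT * gT * gT => u.1) _ _ _ _ _).
    by move=> [[x1 x2] x3]; rewrite !inE /= => /andP[/andP[/andP[-> ->] _] _].
  move=> [x1 x2] _; set S := [set _ in _ | _].
  have inj : {in S &, injective (fun u : gT * gT * gT => u.2)}.
    move=> [u c] [u' c']; rewrite !inE /=.
    by move=> /andP[_ /eqP ->] /andP[_ /eqP ->] ->.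
  rewrite -(card_in_imset inj).
  apply: leq_trans (_ : #|[set x1^-1%g; x2]| <= _); last by rewrite cards2; case: eqP.
  apply: subset_leq_card; apply/subsetP => _ /imsetP[[[a b] c] + ->].
  by rewrite !inE /= => /andP[/andP[_ ab] /eqP[<- <-]].
apply: leq_trans cover _; rewrite leq_add2l; apply: leq_trans (leq_add le1 le2) _.
by rewrite -mulnDl -addnA.
Qed.

(** If [#|B|] is at least [8 * L + 6], half of all triples are generic and [card_generic] concludes.
    Otherwise [#|B|] is at most [14 * maxn L 1], and [L ^ 3 <= L ^ 4] is controlled by
    [line_bound]. *)
Lemma card_trace_slice : #|B| ^ 3 <= 14 ^ 3 * #|H ^+ 3|%g ^ 2.
Proof.
have [L leL2 leL] := line_bound.
have := leq_trans (card_not_generic leL) (leq_add card_generic (leqnn _)).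
have : #|H ^+ 2|%g <= #|H ^+ 3|%g by rewrite subset_leq_card ?expgs_leq.
have : 0 < #|H ^+ 3|%g by apply/card_gt0P; exists 1%g; rewrite expgs_one.
move: #|H ^+ 2|%g #|H ^+ 3|%g #|B| leL2 => m n b leL2 n0 lemn leb.
have m2 : m ^ 2 <= n ^ 2 by rewrite leq_exp2r.
have [big|small] := leqP (8 * L + 6) b.
  have le : 2 * (4 * L + 3) * b ^ 2 <= b * b ^ 2 by rewrite leq_mul2r; apply/orP;
    right; lia.
  have b3 : b ^ 3 = b * b ^ 2 by rewrite expnS.
  have c14 : 4 <= 14 ^ 3 by [].
  have : b ^ 3 <= 4 * n ^ 2 by lia.
  by move/leq_trans; apply; rewrite leq_mul2r c14 orbT.
have lb : b <= 14 * maxn L 1 by lia.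
have := leq_exp2r b (14 * maxn L 1) (isT : 0 < 3); rewrite lb expnMn => le.
apply: leq_trans le _; rewrite leq_mul2l; apply/orP; right.
have max2 : maxn L 1 ^ 2 <= n by case: (leqP L 1) => // _; rewrite exp1n.
have : (maxn L 1 ^ 2) ^ 2 <= n ^ 2 by rewrite leq_exp2r.
by rewrite -expnM; apply: leq_trans; rewrite leq_pexp2l // leq_max orbT.
Qed.

End TraceSlice.

(** * Centralisers and pivoting *)

Local Open Scope nat_scope.

Section Centralisers.
Variable F : finFieldType.
Local Notation gT := {'GL_2[F]}.
Local Notation q := #|F|.
Implicit Types (x y z : gT).
Hypothesis two0 : (2%:R != 0 :> F)%R.

(** The entries of the commutator equation are the minors of the two traceless parts. *)
Lemma commute_nonscalar x y : nonscalar x -> y \in 'C[x]%g ->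
  exists k : F, [/\ ea y - ed y = k * (ea x - ed x), eb y = k * eb x &
                    ec y = k * ec x]%R.
Proof.
move=> nsx /cent1_mulE xy.
have := (congr1 (@ea F) xy, congr1 (@eb F) xy, congr1 (@ec F) xy);
  rewrite !mulE => -[[ha hb] hc].
have bc : (eb x * ec y = eb y * ec x)%R by apply: (eq_comb1 (k1 := 1%R) ha); ring.
have ab : ((ea x - ed x) * eb y = (ea y - ed y) * eb x)%R by apply: (eq_comb1
  (k1 := 1%R) hb); ring.
have ac : ((ea x - ed x) * ec y = (ea y - ed y) * ec x)%R by apply: (eq_comb1 (k1 :=
  (-1)%R) hc); ring.
have nx0 : ~~ [&& ea x - ed x == 0, eb x == 0 & ec x == 0]%R.
  by move: nsx; rewrite /nonscalar subr_eq0 andbA andbC.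
exact: proportional nx0 ab bc ac.
Qed.

(** The matrices commuting with a nonscalar [y] are the combinations of [1] and [y], which commute
    with each other. *)
Lemma commute_nonscalar_trans x y z : nonscalar y ->
  x \in 'C[y]%g -> z \in 'C[y]%g -> x \in 'C[z]%g.
Proof.
move=> nsy yx yz.
have [k [ka kb kc]] := commute_nonscalar nsy yx.
have [l [la lb lc]] := commute_nonscalar nsy yz.
have {}ka : ea x = (ed x + k * (ea y - ed y))%R by rewrite -ka; ring.
have {}la : ea z = (ed z + l * (ea y - ed y))%R by rewrite -la; ring.
by apply/cent1P/entriesP; rewrite !mulE ?(ka, la, kb, kc, lb, lc); ring.
Qed.

Local Notation C x := 'C_(SL2_group F)[x]%g.

(** The traceless part of [y] is [k] times that of [x]. Comparing discriminants gives a quadratic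
    equation for [k], with leading coefficient nonzero by regularity, and [k] and [r] determine
    [y]. *)
Lemma card_cent_trace x r : x \in SL2 F -> regular x ->
  #|[set y in C x | tr y == r]| <= 2.
Proof.
move=> xG regx; have nsx := regular_nonscalar xG regx.
pose R := [set k : F | ((tr x ^+ 2 - 4%:R) * k ^+ 2 + 0 * k + (4%:R - r ^+ 2) == 0)%R].
have leR : #|R| <= 2.
  apply: leq_trans (card_quadratic _) _; last by case: eqP.
  by case/andP: regx => _; rewrite -subr_eq0 => /negbTE ->.
pose g k := mk ((r - k * tr x) / 2%:R + k * ea x)%R (k * eb x)%R (k * ec x)%R
               ((r - k * tr x) / 2%:R + k * ed x)%R.
apply: leq_trans leR; apply: leq_trans (leq_imset_card g R).
apply: subset_leq_card; apply/subsetP => y; case/setIdP=> /setIP[yG xy] /eqP ty.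
have [k [ka kb kc]] := commute_nonscalar nsx xy.
apply/imsetP; exists k; rewrite ?inE.
  apply/eqP; have dx := SL2_det xG; have dy := SL2_det yG.
  have disc : ((ea y - ed y) ^+ 2 + 4%:R * eb y * ec y =
      k ^+ 2 * ((ea x - ed x) ^+ 2 + 4%:R * eb x * ec x))%R.
    by rewrite ka kb kc; ring.
  apply: (eq_comb4 (k1 := (-1)%R) (k2 := (k ^+ 2 * 4%:R)%R) (k3 := (- 4%:R)%R)
    (k4 := (tr y + r)%R) disc dx dy ty).
  by rewrite /tr; ring.
rewrite -(mk_eta yG) /g kb kc -ty /tr; congr (mk _ _ _ _).
- apply: (mulfI two0); apply: (eq_comb1 (k1 := 1%R) ka); field; exact: two0.
- apply: (mulfI two0); apply: (eq_comb1 (k1 := (-1)%R) ka); field; exact: two0.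
Qed.

Lemma card_cent_regular x : x \in SL2 F -> regular x -> #|C x| <= 2 * q.
Proof.
move=> xG regx; rewrite -cardsT.
apply: (@card_le_fibers _ _ (@tr F)) => [y _|r _]; first by rewrite inE.
exact: card_cent_trace.
Qed.

Lemma card_cent_irregular x : x \in SL2 F -> regular x ->
  #|[set y in C x | ~~ regular y]| <= 6.
Proof.
move=> xG regx; pose S r := [set y in C x | tr y == r].
have sub : [set y in C x | ~~ regular y] \subset S 0%R :|: (S 2%:R%R :|: S (- 2%:R)%R).
  apply/subsetP => y; rewrite inE => /andP[yC].
  have yS r : tr y = r -> y \in S r by move=> ty; rewrite inE yC ty eqxx.
  rewrite /regular negb_and !negbK => /orP[/eqP t0|/eqP t4].
    by apply/setUP; left; apply: yS.
  have : ((tr y - 2%:R) * (tr y + 2%:R) == 0)%R.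
    by apply/eqP; apply: (eq_comb1 (k1 := 1%R) t4); ring.
  rewrite mulf_eq0 subr_eq0 addr_eq0 => /orP[]/eqP ty; apply/setUP; right; apply/setUP.
    by left; apply: yS.
  by right; apply: yS.
apply: leq_trans (subset_leq_card sub) _.
have leS r : #|S r| <= 2 by apply: card_cent_trace.
apply: leq_trans (leq_card_setU _ _) _; rewrite -[6]/(2 + (2 + 2)) leq_add //.
by apply: leq_trans (leq_card_setU _ _) _; rewrite leq_add.
Qed.

End Centralisers.

(** * Pivoting over the conjugates of a torus *)

Section Pivot.
Variables (gT : finGroupType) (G : {group gT}) (A : {set gT}) (T : eqType).
Variables (f : gT -> T) (reg : pred gT) (q K : nat).
Implicit Types (x y z g : gT).

Hypotheses (A1 : 1%g \in A) (AV : A^-1%g = A) (genA : <<A>>%g = G).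
Hypothesis fJ : forall x g, f (x ^ g)%g = f x.
Hypothesis regJ : forall x g, reg (x ^ g)%g = reg x.
Hypothesis reg_trans : forall x y z, y \in G ->
  reg y -> x \in 'C[y]%g -> z \in 'C[y]%g -> x \in 'C[z]%g.
Hypothesis reg_cent : {in G, forall x, reg x -> #|'C_G[x]%g| <= 2 * q}.
Hypothesis reg_fib : {in G, forall x r,
  reg x -> #|[set y in 'C_G[x]%g | f y == r]| <= 2}.
Hypothesis reg_irr : {in G, forall x, reg x -> #|[set y in 'C_G[x]%g | ~~ reg y]| <= 6}.

Let N := #|A ^+ 12|%g.
Hypothesis slice : {in G, forall y, reg y ->
  #|[set x in (A ^+ 4)%g | f x == f y]| ^ 3 <= K * N ^ 2}.

Let sAG n : (A ^+ n)%g \subset G.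
Proof. by apply: expgs_sub; rewrite -genA subset_gen. Qed.

Let inG n x : x \in (A ^+ n)%g -> x \in G.
Proof. exact: (subsetP (sAG n)). Qed.

Let E x := 'C_(A ^+ 2)[x]%g.

(** [z ^ g^-1] is one of at most 2 elements of the centraliser of [x] with the same [f], and each of
    them determines [g] up to the centraliser of [z]. *)
Let card_conj_cent x z : x \in G -> reg x -> z \in G -> reg z ->
  #|[set g in G | z \in 'C[x ^ g]%g]| <= 4 * q.
Proof.
move=> xG regx zG regz; set D := [set _ in _ | _].
apply: leq_trans (_ : 2 * q * #|[set w in 'C_G[x]%g | f w == f z]| <= _); last first.
  have := reg_fib xG (f z) regx; move: #|[set _ in _ | _]| => m; nia.
apply: (@card_le_fibers _ _ (fun g => z ^ g^-1)%g) => [g|w _].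
  case/setIdP=> gG; rewrite cent1_conj => zc.
  apply/setIdP; rewrite fJ eqxx; split=> //.
  by apply/setIP; split=> //; apply: groupJ; rewrite ?groupV.
set S := [set _ in _ | _].
have [-> | [g0]] := set_0Vmem S; first by rewrite cards0.
case/setIdP=> /setIdP[g0G _] /eqP zg0.
apply: leq_trans (reg_cent zG regz).
rewrite -(card_imset _ (mulgI g0^-1%g)); apply: subset_leq_card.
apply/subsetP => _ /imsetP[g /setIdP[/setIdP[gG _] /eqP zg] ->].
apply/setIP; split; first by apply: groupM; rewrite ?groupV.
by rewrite -[g]invgK; apply: cent1_quotient; rewrite zg0 zg.
Qed.

(** Orbit counting: [a |-> y ^ a^-1] maps [A] into the slice of [A ^+ 4], and its fibres embed into
    [E y] by [a |-> a0^-1 * a]. *)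
Let card_torus y : y \in (A ^+ 2)%g -> reg y -> #|A| ^ 3 <= K * N ^ 2 * #|E y| ^ 3.
Proof.
move=> yA regy; have yG := inG yA.
have leA : #|A| <= #|E y| * #|[set x in (A ^+ 4)%g | f x == f y]|.
  apply: (@card_le_fibers _ _ (fun a => y ^ a^-1)%g) => [a aA|w _].
    rewrite inE fJ eqxx andbT conjgE invgK.
    rewrite -[4]/(1 + (2 + 1)) mem_expgsD ?expg1 // mem_expgsD ?expg1 //.
    by rewrite -AV memV_invg.
  set S := [set _ in _ | _].
  have [-> | [a0]] := set_0Vmem S; first by rewrite cards0.
  case/setIdP=> a0A /eqP ya0.
  rewrite -(card_imset (mem S) (mulgI a0^-1%g)); apply: subset_leq_card.
  apply/subsetP => _ /imsetP[a /setIdP[aA /eqP ya] ->].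
  apply/setIP; split.
    by rewrite -[2]/(1 + 1) mem_expgsD ?expg1 // -AV memV_invg.
  by rewrite -[a]invgK; apply: cent1_quotient; rewrite ya0 ya.
have := leq_exp2r #|A| (#|E y| * #|[set x in (A ^+ 4)%g | f x == f y]|) (isT : 0 < 3).
rewrite leA expnMn => le; apply: leq_trans le _.
by rewrite mulnC leq_mul2r slice ?orbT.
Qed.

(* If the conjugate torus meets [A ^+ 2] in no regular element, then the elements
   of [A] are essentially in distinct cosets of it. *)
Let card_new_torus y a : y \in (A ^+ 2)%g -> reg y -> a \in A ->
  ~~ [exists z in (A ^+ 2)%g, reg z && (z \in 'C[y ^ a]%g)] ->
  #|A| * #|E y| <= 6 * N.
Proof.
move=> yA regy aA /exists_inPn none; have yG := inG yA; have aG := inG (n := 1) aA.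
have VA b : b \in A -> b^-1%g \in A by rewrite -{2}AV memV_invg.
apply: leq_trans (_ : 6 * #|(A ^+ 5)%g| <= _); last first.
  by rewrite leq_mul2l subset_leq_card ?expgs_leq.
rewrite -cardsX.
apply: (@card_le_fibers _ _ (fun u : gT * gT => u.1 * u.2 ^ a)%g _ _ _ _ _).
  move=> [b s] /setXP[/= bA /setIP[sA _]].
  rewrite -[5]/(1 + (1 + (2 + 1))) mem_expgsD ?expg1 // conjgE.
  by rewrite mem_expgsD ?expg1 ?VA // mem_expgsD ?expg1.
move=> w _; set S := [set _ in _ | _].
have [-> | [[b0 s0]]] := set_0Vmem S; first by rewrite cards0.
case/setIdP=> /setXP[/= b0A /setIP[s0A s0C]] /eqP w0.
have yaG : (y ^ a)%g \in G by apply: groupJ.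
have regya : reg (y ^ a)%g by rewrite regJ.
apply: leq_trans (reg_irr yaG regya).
have inj : {in S &, injective (fun u : gT * gT => b0^-1 * u.1)%g}.
  move=> [b s] [b' s'] /setIdP[_ /= /eqP e] /setIdP[_ /= /eqP e'] /mulgI bb.
  by move: e; rewrite -e' bb => /mulgI/conjg_inj ->.
rewrite -(card_in_imset inj); apply: subset_leq_card.
apply/subsetP => _ /imsetP[[b s] /setIdP[/setXP[/= bA /setIP[sA sC]] /eqP e] ->].
have bA2 : (b0^-1 * b)%g \in (A ^+ 2)%g.
  by rewrite -[2]/(1 + 1) mem_expgsD ?expg1 ?VA.
have bC : (b0^-1 * b)%g \in 'C[y ^ a]%g.
  have -> : (b0^-1 * b = (s0 * s^-1) ^ a)%g.
    by apply: (mulIg (s ^ a)%g); rewrite -mulgA e -w0 mulKg conjMg conjVg mulgKV.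
  by rewrite cent1J memJ_conjg groupM ?groupV.
apply/setIdP; split; first by rewrite inE bC (inG bA2).
by have := none _ bA2; rewrite bC andbT.
Qed.

(** [m] is the least number allowed by the inequality of [card_torus], so every regular [z] in
    [A ^+ 2] has [#|E z| >= m]. Either a conjugation step leads to a torus missed by the regular
    elements of [A ^+ 2], or all conjugates are hit and are summed over. *)
Lemma pivot y0 : y0 \in (A ^+ 2)%g -> reg y0 -> exists m,
  #|A| ^ 3 <= K * N ^ 2 * m ^ 3 /\
  (#|A| * m <= 6 * N \/ #|G| * (m - 6) <= 4 * q * N).
Proof.
move=> y0A regy0; have y0G := inG y0A.
have exm : exists m, #|A| ^ 3 <= K * N ^ 2 * m ^ 3.
  by exists #|E y0|; apply: card_torus.
have [m mP minm] := ex_minnP exm; exists m; split=> //.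
have [le|gt] := leqP (#|A| * m) (6 * N); [by left | right].
have all_involved g : g \in <<A>>%g ->
    exists2 z, z \in (A ^+ 2)%g & reg z && (z \in 'C[y0 ^ g]%g).
  rewrite -groupV -{2}[g]invgK; move: (g^-1)%g.
  apply: (gen_mul_ind (P := fun h =>
    exists2 z, z \in (A ^+ 2)%g & reg z && (z \in 'C[y0 ^ h^-1]%g))).
    by exists y0; rewrite // regy0 invg1 conjg1 cent1id.
  move=> a h aA [z zA /andP[regz zC]].
  have aA' : (a^-1)%g \in A by rewrite -AV memV_invg.
  case: (boolP [exists z' in (A ^+ 2)%g, reg z' && (z' \in 'C[z ^ a^-1]%g)]).
    case/exists_inP=> z' zA' /andP[regz' zC']; exists z' => //.
    rewrite regz' invMg conjgM /=.
    have zaG : (z ^ a^-1)%g \in G by apply: groupJ;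
      [apply: inG zA | apply: (inG (n := 1))].
    rewrite cent1C; apply: (reg_trans zaG); rewrite ?regJ //.
    by rewrite cent1J memJ_conjg cent1C.
  move/(card_new_torus zA regz aA') => le; move: gt; rewrite ltnNge => /negP[].
  by apply: leq_trans le; rewrite leq_mul2l minm ?orbT ?card_torus.
(* Double counting of the pairs formed by [g] and a regular element of [A ^+ 2] in the conjugate
   torus of [g]. *)
pose D := [set u in setX G (A ^+ 2)%g | reg u.2 && (u.2 \in 'C[y0 ^ u.1]%g)].
have upper : #|D| <= 4 * q * N.
  apply: leq_trans (_ : 4 * q * #|[set z in (A ^+ 2)%g | reg z]| <= _); last first.
    rewrite leq_mul2l; apply/orP; right; apply: subset_leq_card.
    by apply/subsetP => z /setIdP[zA _]; apply: (subsetP (expgs_leq A1 _)) zA.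
  apply: (@card_le_fibers _ _ (fun u : gT * gT => u.2)) => [[g z]|z].
    by case/setIdP=> /setXP[/= _ zA] /andP[regz _]; apply/setIdP.
  case/setIdP=> zA regz; apply: leq_trans (card_conj_cent y0G regy0 (inG zA) regz).
  set S := [set _ in _ | _].
  have inj : {in S &, injective (fun u : gT * gT => u.1)}.
    move=> [g w] [g' w'] /setIdP[_ /= /eqP ->] /setIdP[_ /= /eqP ->] /= -> //.
  rewrite -(card_in_imset inj); apply: subset_leq_card.
  apply/subsetP => _ /imsetP[[g w] /setIdP[/setIdP[/setXP[/= gG _] /andP[_ wC]] /eqP
    wz] ->].
  by apply/setIdP; rewrite -wz.
apply: leq_trans upper.
have DE : #|D| = \sum_(g in G) #|[set z in (A ^+ 2)%g | reg z && (z \in 'C[y0 ^ g]%g)]|.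
  rewrite -sum1_card (partition_big (fun u : gT * gT => u.1) (mem G)) /=; last first.
    by move=> [g z] /setIdP[/setXP[]].
  apply: eq_bigr => g gG; rewrite sum1dep_card -[LHS](card_in_imset
    (f := fun u : gT * gT => u.2)).
    congr #|pred_of_set _|; apply/setP => z; apply/imsetP/setIdP.
      case=> -[g' w]; rewrite inE /= => /andP[/setIdP[/setXP[/= _ zA] zP] /eqP <-] ->.
      by split.
    case=> zA zP; exists (g, z) => //; rewrite inE /= eqxx andbT.
    by apply/setIdP; split=> //; apply/setXP.
  move=> [g1 z1] [g2 z2]; rewrite !inE /= => /andP[_ /eqP ->] /andP[_ /eqP ->] -> //.
rewrite DE -sum_nat_const; apply: leq_sum => g gG.
rewrite -genA in gG; have [z zA /andP[regz zC]] := all_involved g gG.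
have zG := inG zA.
have lem : m <= #|E z| by rewrite minm ?card_torus.
rewrite leq_subLR; apply: leq_trans lem _.
apply: leq_trans (_ : #|[set y in 'C_G[z]%g | ~~ reg y] :|:
    [set y in (A ^+ 2)%g | reg y && (y \in 'C[y0 ^ g]%g)]| <= _).
  apply: subset_leq_card; apply/subsetP => y /setIP[yA yC].
  apply/setUP; case: (boolP (reg y)) => regy; [right | left]; apply/setIdP.
    split; rewrite // regy /=; apply: (reg_trans zG regz) => //.
    by rewrite cent1C.
  by split=> //; apply/setIP; split=> //; apply: inG yA.
apply: leq_trans (leq_card_setU _ _) _; rewrite leq_add2r.
exact: reg_irr.
Qed.

End Pivot.

(** * Large sets *)

Local Open Scope nat_scope.

(** Cauchy-Schwarz for the fibre sizes [N c], whose squares sum to the number of collisions. *)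
Lemma card_collisions (T U : finType) (f : T -> U) (D : {set T}) :
  #|D| ^ 2 <= #|f @: D| * #|[set w in setX D D | f w.1 == f w.2]|.
Proof.
pose I := f @: D; pose N c := #|[set x in D | f x == c]|.
have cardD : #|D| = \sum_(c in I) N c.
  rewrite -sum1_card (partition_big f (mem I)) /=; last by move=> x; apply: imset_f.
  by apply: eq_bigr => c _; rewrite sum1dep_card.
have cardE : #|[set w in setX D D | f w.1 == f w.2]| = \sum_(c in I) N c ^ 2.
  rewrite -sum1_card (partition_big (fun w => f w.1) (mem I)) /=; last first.
    by move=> [x y] /setIdP[/setXP[/= xD _] _]; apply: imset_f.
  apply: eq_bigr => c _; rewrite sum1dep_card expnS expn1 -cardsX.
  apply: eq_card => -[x y]; rewrite in_set; apply/andP/setXP.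
    by case=> /setIdP[/setXP[/= xD yD] /eqP fxy] /eqP fxc;
      rewrite !inE xD yD -fxy fxc eqxx.
  case=> /= /setIdP[xD /eqP fxc] /setIdP[yD /eqP fyc]; rewrite fxc; split=> //.
  by apply/setIdP; rewrite /= fxc fyc; split=> //; apply/setXP.
rewrite cardE cardD -(leq_pmul2l (isT : 0 < 2)).
have -> : 2 * (\sum_(c in I) N c) ^ 2 = \sum_(c in I) \sum_(d in I) 2 * (N c * N d).
  rewrite expnS expn1 big_distrl big_distrr /=; apply: eq_bigr => c _.
  by rewrite big_distrr big_distrr.
apply: leq_trans (_ : \sum_(c in I) \sum_(d in I) (N c ^ 2 + N d ^ 2) <= _).
  by apply: leq_sum => c _; apply: leq_sum => d _; apply: nat_Cauchy.
under eq_bigr => c _ do rewrite big_split /= sum_nat_const.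
by rewrite big_split /= sum_nat_const -big_distrr /= addnn mul2n.
Qed.

Section Dilates.
Variable F : finFieldType.
Local Notation q := #|F|.
Implicit Types X D : {set F}.

Definition dilate_sum X (d : F) := [set (u.1 + d * u.2)%R | u in setX X X].

(* Second moment: over all dilations [d] in the field the number of collisions of
   [(x, y) |-> x + d * y] is on average what it would be for a random map, so few
   dilations can have small image. *)
Lemma large_dilate_sum X D : q ^ 2 < #|X| ^ 2 * #|D| ->
  exists2 d, d \in D & q < 2 * #|dilate_sum X d|.
Proof.
move=> big; pose P := setX X X; pose p := #|X| ^ 2.
have cardP : #|P| = p by rewrite cardsX /p expnS expn1.
have X0 : 0 < p by rewrite lt0n; apply: contraTneq big => p0; rewrite -/p p0.
case: (boolP [exists d in D, q < 2 * #|dilate_sum X d|]) => [/exists_inP //|].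
move/exists_inPn=> small.
pose f (d : F) (u : F * F) := (u.1 + d * u.2)%R.
pose E d := #|[set w in setX P P | f d w.1 == f d w.2]|.
have CS d : p ^ 2 <= #|dilate_sum X d| * E d by rewrite -cardP; apply: card_collisions.
(* Dilations in [D] are assumed to have at most [q / 2] values, so Cauchy-Schwarz doubles their
   number of collisions. *)
have lower d : p ^ 2 * (1 + (d \in D)) <= q * E d.
  case: (boolP (d \in D)) => dD.
    by have := small _ dD; have := CS d; rewrite -leqNgt; nia.
  have := CS d; have : #|dilate_sum X d| <= q by apply: max_card.
  by rewrite /=; nia.
(* Equal points collide for all [q] dilations, distinct points for at most one. *)
have upper : \sum_(d : F) E d <= q * p + p ^ 2.
  have -> : \sum_(d : F) E d = \sum_(w in setX P P) #|[set d : F | f d w.1 == f d w.2]|.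
    under [LHS]eq_bigr => d _ do rewrite /E -sum1_card.
    rewrite (exchange_big_dep (mem (setX P P))) /=; last by move=> d w _ /setIdP[].
    apply: eq_bigr => w wP; rewrite sum1dep_card; apply: eq_card => d.
    by rewrite !in_set; move: wP; rewrite !inE => ->.
  apply: leq_trans (_ : \sum_(w in setX P P) ((w.1 == w.2) * q + 1) <= _).
    apply: leq_sum => -[[x y] [x' y']] _ /=; rewrite xpair_eqE /f /=.
    case: (eqVneq y y') => [<-|ney]; last first.
      rewrite andbF add0n; apply/card_le1_eqP => d d'; rewrite !inE => /eqP e /eqP e'.
      have ny : (y - y' != 0)%R by rewrite subr_eq0.
      by apply: (mulIf ny); apply: (eq_comb2 (k1 := 1%R) (k2 := (-1)%R) e' e); ring.
    rewrite andbT; case: (eqVneq x x') => [_|nex].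
      by rewrite mul1n (leq_trans (max_card _)) ?leq_addr.
    rewrite (_ : [set _ | _] = set0) ?cards0 //; apply/setP => d.
    by rewrite !inE (inj_eq (addIr _)) (negbTE nex).
  rewrite big_split /= sum_nat_const cardsX cardP muln1 -[p * p]/(p ^ 2) leq_add2r.
  rewrite -big_distrl /= mulnC leq_mul2l; apply/orP; right.
  have -> : \sum_(w in setX P P) (w.1 == w.2) = #|[set w in setX P P | w.1 == w.2]|.
    rewrite -sum1_card; under [RHS]eq_bigl => w do rewrite in_set.
    by rewrite big_mkcondr; apply: eq_bigr => w _; case: eqP.
  rewrite -cardP; have inj : {in [set w in setX P P | w.1 == w.2] &,
    injective (fst : _ * _ -> F * F)}.
    by move=> [u v] [u' v'] /setIdP[_ /= /eqP ->] /setIdP[_ /= /eqP ->] ->.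
  rewrite -(card_in_imset inj); apply: subset_leq_card.
  by apply/subsetP => _ /imsetP[[u v] /setIdP[/setXP[uP _] _] ->].
have : \sum_(d : F) p ^ 2 * (1 + (d \in D)) <= q * (q * p + p ^ 2).
  by apply: leq_trans (leq_mul (leqnn q) upper); rewrite big_distrr; apply: leq_sum.
rewrite -big_distrr big_split /=.
have -> : \sum_(d : F) 1 = q by rewrite sum1_card; apply: eq_card.
have -> : \sum_(d : F) (d \in D) = #|D|.
  by rewrite -sum1_card [RHS]big_mkcond; apply: eq_bigr => d _; case: (d \in D).
move=> le; exfalso; move: le big X0; rewrite -/p.
move: (p) #|F| #|D| => a b c; clear => le lt a0.
by have : a * b ^ 2 < a * (a * c); [rewrite ltn_pmul2l | nia].
Qed.

Lemma sumset_full (Y : {set F}) z : q < 2 * #|Y| ->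
  exists y1 y2, [/\ y1 \in Y, y2 \in Y & z = (y1 + y2)%R].
Proof.
move=> big; pose Z := [set (z - y)%R | y in Y].
have cardZ : #|Z| = #|Y| by apply: card_imset => y y' /addrI/oppr_inj.
have : 0 < #|Y :&: Z|.
  have := max_card (mem (Y :|: Z)); rewrite cardsU cardZ;
    have := subset_leq_card (subsetIl Y Z).
  by move: #|Y| #|_ :&: _| #|F| big => a b c; lia.
case/card_gt0P=> y1; rewrite inE => /andP[y1Y /imsetP[y2 y2Y def_y1]].
by exists y1, y2; split=> //; rewrite def_y1 subrK.
Qed.

End Dilates.

(** * Large sets yield all unipotents and then the whole group *)

Section LargeSets.
Variable F : finFieldType.
Local Notation gT := {'GL_2[F]}.
Local Notation q := #|F|.
Implicit Types (A : {set gT}) (b c r : F).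

Definition upper b : gT := mk 1%R b 0%R 1%R.
Definition lower c : gT := mk 1%R 0%R c 1%R.
Definition torus r : gT := mk r 0%R 0%R r^-1%R.

Let det_upper b : (1 * 1 - b * 0 = 1 :> F)%R. Proof. by ring. Qed.
Let det_lower c : (1 * 1 - 0 * c = 1 :> F)%R. Proof. by ring. Qed.
Let det_torus r : (r != 0)%R -> (r * r^-1 - 0 * 0 = 1 :> F)%R. Proof. by move=> r0;
  field. Qed.

Definition upperE b := mk_entries (det_upper b).
Definition lowerE c := mk_entries (det_lower c).
Definition torusE r (r0 : (r != 0)%R) := mk_entries (det_torus r0).

Lemma upperM b c : (upper b * upper c = upper (b + c)%R)%g.
Proof. by apply: entriesP; rewrite !mulE !upperE; ring. Qed.

Lemma upper_inj : injective upper.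
Proof. by move=> b c eqbc; have := congr1 (@eb F) eqbc; rewrite !upperE. Qed.

Lemma torusM r s : (r != 0)%R -> (s != 0)%R -> (torus r * torus s = torus (r * s)%R)%g.
Proof.
move=> r0 s0; have rs0 : (r * s != 0)%R by rewrite mulf_neq0.
by apply: entriesP; rewrite !mulE !(torusE r0, torusE s0, torusE rs0); field;
  rewrite ?r0 ?s0.
Qed.

Lemma torus_inj r s : (r != 0)%R -> (s != 0)%R -> torus r = torus s -> r = s.
Proof. by move=> r0 s0 eqrs; have := congr1 (@ea F) eqrs;
  rewrite !(torusE r0, torusE s0). Qed.

Lemma torus_conj_upper r b : (r != 0)%R ->
  (torus r * upper b = upper (r ^+ 2 * b)%R * torus r)%g.
Proof.
move=> r0.
by apply: entriesP; rewrite !mulE !(torusE r0) !upperE; field.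
Qed.

Lemma upper_group_set : group_set [set upper b | b : F].
Proof.
apply/group_setP; split.
  by apply/imsetP; exists 0%R => //; apply: entriesP; rewrite entries1 upperE.
by move=> _ _ /imsetP[b _ ->] /imsetP[c _ ->]; rewrite upperM; apply: imset_f.
Qed.

Lemma torus_group_set : group_set [set torus r | r in [set~ 0%R : F]].
Proof.
apply/group_setP; split.
  have n10 : (1 != 0 :> F)%R := oner_neq0 F.
  apply/imsetP; exists 1%R; first by rewrite !inE.
  by apply: entriesP; rewrite entries1 torusE ?invr1.
move=> _ _ /imsetP[r + ->] /imsetP[s + ->]; rewrite !inE => r0 s0.
by rewrite torusM //; apply: imset_f; rewrite !inE mulf_neq0.
Qed.

Lemma upper_SL2 b : upper b \in SL2 F. Proof. exact: mk_SL2 (det_upper b). Qed.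
Lemma lower_SL2 c : lower c \in SL2 F. Proof. exact: mk_SL2 (det_lower c). Qed.
Lemma torus_SL2 r : (r != 0)%R -> torus r \in SL2 F.
Proof. by move=> r0; exact: mk_SL2 (det_torus r0). Qed.

(** [A ^+ 2] contains many upper unipotents, with parameters [X], and many diagonal matrices, with
    parameters [R]. Conjugation by [torus r] dilates by [r ^ 2], so some [X + r ^ 2 X] fills over
    half of [F] in length [2 + (2 + 2 + 2)]; adding two of its elements reaches everything. *)
Lemma upper_covered A : A \subset SL2 F -> 1%g \in A -> A^-1%g = A ->
  2 * #|SL2 F| ^ 3 < #|A| ^ 3 * q.-1 ->
  forall b, upper b \in (A ^+ 16)%g.
Proof.
move=> sAG A1 AV large b; set n := #|SL2 F| in large.
pose X := [set c | upper c \in (A ^+ 2)%g].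
pose R := [set r : F | (r != 0)%R && (torus r \in (A ^+ 2)%g)].
pose D := [set (r ^+ 2)%R | r in R].
have A2 : (A^-1 * A = A ^+ 2)%g by rewrite AV !expgS expg0 mulg1.
have cardX : #|A| * q <= #|X| * n.
  have sub : Group upper_group_set \subset SL2 F.
    by apply/subsetP => _ /imsetP[c _ ->]; apply: upper_SL2.
  have := card_subgroup_slice (G := SL2_group F) sAG sub.
  rewrite /= (card_imset _ upper_inj) A2; move/leq_trans; apply.
  rewrite leq_mul2r -(card_imset (mem X) upper_inj); apply/orP; right.
  apply: subset_leq_card; apply/subsetP => u /setIP[cA /imsetP[c _ def_c]].
  by rewrite def_c; apply: imset_f; rewrite inE -def_c.
have cardR : #|A| * q.-1 <= #|R| * n.
  have sub : Group torus_group_set \subset SL2 F.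
    by apply/subsetP => _ /imsetP[r + ->]; rewrite in_setC1; apply: torus_SL2.
  have := card_subgroup_slice (G := SL2_group F) sAG sub.
  have inj : {in [set~ 0%R : F] &, injective torus}.
    by move=> r s; rewrite !inE; apply: torus_inj.
  rewrite /= (card_in_imset inj) cardsC1 A2; move/leq_trans; apply.
  have injR : {in R &, injective torus}.
    by move=> r s; rewrite !inE => /andP[r0 _] /andP[s0 _]; apply: torus_inj.
  rewrite leq_mul2r -(card_in_imset injR); apply/orP; right.
  apply: subset_leq_card; apply/subsetP => u /setIP[rA /imsetP[r r0 def_r]].
  by rewrite def_r; apply: imset_f; rewrite inE -def_r rA andbT; rewrite !inE in r0.
have cardD : #|R| <= 2 * #|D|.
  apply: (@card_le_fibers _ _ (fun r : F => r ^+ 2)%R) => [r|y]; first exact: imset_f.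
  move=> _; apply: leq_trans (_ : #|[set s : F |
    (1 * s ^+ 2 + 0 * s + - y == 0)%R]| <= _).
    apply: subset_leq_card; apply/subsetP => r /setIdP[_ /eqP ry]; rewrite inE.
    by apply/eqP; rewrite -ry; ring.
  apply: leq_trans (card_quadratic _) _; last by rewrite oner_neq0.
  by rewrite oner_eq0.
have big : q ^ 2 < #|X| ^ 2 * #|D|.
  have n0 : 0 < 2 * n ^ 3 by rewrite muln_gt0 expn_gt0 cardG_gt0.
  have q0 : 0 < q ^ 2 by rewrite expn_gt0 ltnW ?card_field_gt1.
  rewrite -(ltn_pmul2l n0).
  apply: leq_trans (_ : #|A| ^ 3 * q.-1 * q ^ 2 <= _); first by rewrite ltn_pmul2r.
  have -> : #|A| ^ 3 * q.-1 * q ^ 2 = (#|A| * q) ^ 2 * (#|A| * q.-1).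
    by rewrite !expnS !expn0; move: #|A| #|F|; clear; move=> a b; lia.
  have -> : 2 * n ^ 3 * (#|X| ^ 2 * #|D|) = (#|X| * n) ^ 2 * (2 * #|D| * n).
    by rewrite !expnS !expn0; move: #|X| #|D| (n); clear; move=> x d n; lia.
  rewrite leq_mul ?leq_exp2r //; apply: leq_trans cardR _.
  by rewrite leq_mul2r cardD orbT.
have [d dD] := large_dilate_sum big.
case/imsetP: dD => r + ->; rewrite inE => /andP[r0 rA] bigsum.
have dilateA y : y \in dilate_sum X (r ^+ 2)%R -> upper y \in (A ^+ 8)%g.
  case/imsetP=> -[c c'] /setXP[/= + +] ->; rewrite !inE => cA cA'.
  rewrite -upperM -[8]/(2 + (2 + 2 + 2)) mem_expgsD //.
  exact: mem_expgs_twist AV (torus_conj_upper c' r0) rA cA'.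
have [y1 [y2 [/dilateA y1A /dilateA y2A ->]]] := sumset_full b bigsum.
by rewrite -upperM -[16]/(8 + 8) mem_expgsD.
Qed.

Lemma lower_covered A : A \subset SL2 F -> 1%g \in A -> A^-1%g = A ->
  2 * #|SL2 F| ^ 3 < #|A| ^ 3 * q.-1 ->
  forall c, lower c \in (A ^+ 16)%g.
Proof.
move=> sAG A1 AV large c.
have det_w : (0 * 0 - 1 * (-1) = 1 :> F)%R by ring.
pose w : gT := mk 0%R 1%R (-1)%R 0%R; have wG : w \in SL2 F := mk_SL2 det_w.
have [B [sBG B1 BV cardB]] := conj_set (G := SL2_group F) sAG A1 AV wG.
rewrite -cardB in large; apply; first exact: upper_covered sBG B1 BV large (- c)%R.
by apply: entriesP; rewrite !mulE !upperE !lowerE !(mk_entries det_w); ring.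
Qed.

(** A matrix with nonzero lower left entry is a product upper, lower, upper, of length 48. When that
    entry vanishes, multiplying by [lower 1] makes it nonzero, at the cost of another 16. *)
Lemma large_set_covers A : A \subset SL2 F -> 1%g \in A -> A^-1%g = A ->
  2 * #|SL2 F| ^ 3 < #|A| ^ 3 * q.-1 -> (A ^+ 64)%g = SL2 F.
Proof.
move=> sAG A1 AV large; apply/eqP; rewrite eqEsubset.
rewrite (expgs_sub (G := SL2_group F)) //=; apply/subsetP => x xG.
have uA := upper_covered sAG A1 AV large; have lA := lower_covered sAG A1 AV large.
have ulu y : y \in SL2 F -> (ec y != 0)%R -> y \in (A ^+ (16 + 16 + 16))%g.
  move=> yG c0; have dy := SL2_det yG.
  suff -> : y = (upper ((ea y - 1) / ec y)%R * lower (ec y) * upper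
    ((ed y - 1) / ec y)%R)%g.
    by rewrite !mem_expgsD.
  apply: entriesP; rewrite !mulE !upperE !lowerE; try by field.
  apply: (mulfI c0); apply: (eq_comb1 (k1 := (-1)%R) dy); by field.
have [c0|c0] := eqVneq (ec x) 0%R; last first.
  by apply: (subsetP (expgs_leq A1 _)) (ulu _ xG c0).
have -> : x = ((x * lower 1%R) * lower (-1)%R)%g.
  by apply: entriesP; rewrite !mulE !lowerE; ring.
rewrite -[64]/(16 + 16 + 16 + 16) mem_expgsD // ulu //.
  by apply: groupM => //; apply: lower_SL2.
rewrite !mulE !lowerE c0 !mul0r add0r mulr1.
apply: contraTneq isT => d0; have := SL2_det xG.
by rewrite c0 d0 !mulr0 subrr => /eqP; rewrite eq_sym oner_eq0.
Qed.

End LargeSets.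

(** * Escape from the irregular elements *)

Local Open Scope ring_scope.

Section Escape.
Variable F : finFieldType.
Local Notation gT := {'GL_2[F]}.
Variable A : {set gT}.
Implicit Types (x y u v h : gT).

Hypotheses (two0 : 2%:R != 0 :> F) (three0 : 3%:R != 0 :> F).
Hypotheses (A1 : 1%g \in A) (AV : A^-1%g = A) (genA : <<A>>%g = SL2 F).

Let AG n x : x \in (A ^+ n)%g -> x \in SL2 F.
Proof.
by apply: (subsetP (expgs_sub (G := SL2_group F) n _)); rewrite /= -genA subset_gen.
Qed.

(** The triple is the matrix [2 u - tr u], twice the traceless part of [u], which avoids halves. *)
Let moved u : nonscalar u -> exists2 h, h \in A &
  forall l, ~~ normalises h (ea u - ed u) (2%:R * eb u) (2%:R * ec u) l.
Proof.
move=> nsu; apply: moved_traceless => //.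
move: nsu; rewrite /nonscalar subr_eq0 !(mulrI_eq0 _ (mulfI two0)).
by rewrite andbA andbC.
Qed.

Let moved_nonscalar h a b c : (forall l, ~~ normalises h a b c l) -> nonscalar h.
Proof.
move=> nh; apply/negP => /and3P[/eqP b0 /eqP c0 /eqP ad]; case/negP: (nh 1).
by rewrite /normalises b0 c0 ad; apply/and4P; split; apply/eqP; ring.
Qed.

(* If [u] and its conjugate [v] are, up to sign, unipotents with different fixed
   lines then the traces of [u v], [u v v], [u v v v] form an arithmetic
   progression up to sign, so one of them is not in {0, 2, -2}. *)
Let regular_of_parabolic u : u \in (A ^+ 2)%g -> nonscalar u -> tr u ^+ 2 = 4%:R ->
  exists2 y, y \in (A ^+ 14)%g & regular y.
Proof.
move=> uA nsu t4; have [h hA nh] := moved nsu.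
have uG := AG uA; have hG : h \in SL2 F by apply: (AG (n := 1)).
pose v := (h * u * h^-1)%g.
have vh : (v * h = h * u)%g by rewrite /v mulgKV.
have vA : v \in (A ^+ 4)%g := mem_expgsJ AV (mem_expgs1 hA) uA.
have vG := AG vA.
have tv : tr v = tr u by rewrite /v trMC mulKg.
clearbody v.
(* Equality would make the nilpotent parts of [u] and [v] orthogonal for the trace form, hence
   proportional, and [h] would normalise that of [u]. *)
have T2 : tr (u * v)%g != 2%:R.
  apply/eqP => T2.
  have du := SL2_det uG; have dv := SL2_det vG.
  pose a := ea u - ed u; pose b := 2%:R * eb u; pose c := 2%:R * ec u.
  pose a' := ea v - ed v; pose b' := 2%:R * eb v; pose c' := 2%:R * ec v.
  have nil : a ^+ 2 + b * c = 0.
    apply: (eq_comb2 (k1 := 1) (k2 := - 4%:R) t4 du); rewrite /a /b /c /tr; ring.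
  have nil' : a' ^+ 2 + b' * c' = 0.
    have t4' : tr v ^+ 2 = 4%:R by rewrite tv.
    apply: (eq_comb2 (k1 := 1) (k2 := - 4%:R) t4' dv); rewrite /a' /b' /c' /tr; ring.
  have tmm : 2%:R * a * a' + b * c' + c * b' = 0.
    apply: (eq_comb3 (k1 := 4%:R) (k2 := - 2%:R) (k3 := - 2%:R * tr u) T2 t4 tv).
    by rewrite /a /b /c /a' /b' /c' /tr !mulE; ring.
  have sq0 (z : F) : z ^+ 2 = 0 -> z = 0 by move/eqP; rewrite sqrf_eq0 => /eqP.
  have ab : a * b' = a' * b.
    apply/subr0_eq/sq0.
    by apply: (eq_comb3 (k1 := b' ^+ 2) (k2 := b ^+ 2) (k3 := -
      (b * b')) nil nil' tmm); ring.
  have ac : a * c' = a' * c.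
    apply/subr0_eq/sq0.
    by apply: (eq_comb3 (k1 := c' ^+ 2) (k2 := c ^+ 2) (k3 := -
      (c * c')) nil nil' tmm); ring.
  have bc : b * c' = b' * c.
    apply/subr0_eq/sq0.
    by apply: (eq_comb3 (k1 := - 4%:R * b' * c') (k2 := 4%:R * a ^+ 2)
      (k3 := b * c' + c * b' - 2%:R * a * a') nil nil' tmm); ring.
  have m0 : ~~ [&& a == 0, b == 0 & c == 0].
    move: nsu; rewrite /nonscalar subr_eq0 !(mulrI_eq0 _ (mulfI two0)).
    by rewrite andbA andbC.
  have [l [la lb lc]] := proportional m0 ab bc ac.
  have := (congr1 (@ea F) vh, congr1 (@eb F) vh, congr1 (@ec F) vh, congr1 (@ed F) vh).
  rewrite !mulE => -[[[e1 e2] e3] e4].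
  case/negP: (nh l); rewrite /normalises -/a -/b -/c.
  move: la lb lc; rewrite /a' /b' /c' => la lb lc.
  apply/and4P; split; apply/eqP.
  - apply: (eq_comb4 (k1 := - 2%:R) (k2 := ea h) (k3 := ea h) (k4 := ec h) e1 tv la lb).
    by rewrite /a /b /c /tr; ring.
  - apply: (eq_comb4 (k1 := - 2%:R) (k2 := eb h) (k3 := eb h) (k4 := ed h) e2 tv la lb).
    by rewrite /a /b /c /tr; ring.
  - apply: (eq_comb4 (k1 := - 2%:R) (k2 := ec h) (k3 := - ec h)
      (k4 := ea h) e3 tv la lc).
    by rewrite /a /b /c /tr; ring.
  - apply: (eq_comb4 (k1 := - 2%:R) (k2 := ed h) (k3 := - ed h)
      (k4 := eb h) e4 tv la lc).
    by rewrite /a /b /c /tr; ring.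
have tuvv : tr (u * v * v)%g = tr u * (tr (u * v)%g - 1) by rewrite trMM // tv; ring.
have tuvvv : tr (u * v * v * v)%g = 3%:R * tr (u * v)%g - 4%:R.
  rewrite trMM // tuvv tv.
  by apply: (eq_comb1 (k1 := tr (u * v)%g - 1) t4); ring.
have uv6 : (u * v)%g \in (A ^+ 6)%g by apply: (mem_expgsM uA vA).
have uv10 : (u * v * v)%g \in (A ^+ 10)%g by apply: (mem_expgsM uv6 vA).
have uv14 : (u * v * v * v)%g \in (A ^+ 14)%g by apply: (mem_expgsM uv10 vA).
have four0 : 4%:R != 0 :> F by rewrite (_ : 4%:R = 2%:R * 2%:R) ?mulf_neq0 //; ring.
have [reguv|] := boolP (regular (u * v)%g).
  by exists (u * v)%g => //; apply: (subsetP (expgs_leq A1 _)) uv6.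
(* If [tr (u * v)] is 0, then [u * v * v * v] has trace -4 and [16 - 4 = 12]. If it is -2, then
   [u * v * v] has trace [-3 * tr u], of square 36, and [36 - 4 = 32]. Both differences are nonzero
   in [F]. *)
rewrite /regular negb_and !negbK => /orP[/eqP T0|/eqP Tsq].
  exists (u * v * v * v)%g => //;
    rewrite /regular tuvvv T0 mulr0 sub0r oppr_eq0 four0 /=.
  rewrite sqrrN -subr_eq0 (_ : _ - _ = 2%:R * 2%:R * 3%:R); last by ring.
  by rewrite !mulf_neq0.
have Tm2 : tr (u * v)%g = - 2%:R.
  apply/eqP; rewrite -addr_eq0.
  have : (tr (u * v)%g - 2%:R) * (tr (u * v)%g + 2%:R) == 0.
    by apply/eqP; apply: (eq_comb1 (k1 := 1) Tsq); ring.
  by rewrite mulf_eq0 subr_eq0 (negbTE T2).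
have tu0 : tr u != 0 by apply: contraNneq four0 => tu0; rewrite -t4 tu0 expr0n.
exists (u * v * v)%g; first by apply: (subsetP (expgs_leq A1 _)) uv10.
rewrite /regular tuvv Tm2 (_ : - 2%:R - 1 = - 3%:R); last by ring.
rewrite mulf_neq0 ?oppr_eq0 //= exprMn t4 -subr_eq0.
rewrite (_ : _ - _ = 2%:R * 2%:R * (2%:R * (2%:R * 2%:R))); last by ring.
by rewrite !mulf_neq0.
Qed.

(** After the parabolic case only trace 0 is left. Take [h] moving the traceless part of [u]. If
    [u], [h] and [u * h] all have trace 0, then [h] anticommutes with [u], and if [u * h] is scalar,
    then [h] commutes with [u]; both contradict the choice of [h]. *)
Lemma regular_element : exists2 y, y \in (A ^+ 14)%g & regular y.
Proof.
have [u uA nsu] : exists2 u, u \in A & nonscalar u.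
  have [|h hA /moved_nonscalar nsh] := @moved_traceless F A 0 1 0 two0 genA.
    by rewrite oner_eq0 andbF.
  by exists h.
have A12 x : x \in A -> x \in (A ^+ 2)%g by move=> xA;
  apply: (subsetP (expgs_leq (m := 1) A1 _)).
have decide x : x \in (A ^+ 2)%g -> nonscalar x ->
    (exists2 y, y \in (A ^+ 14)%g & regular y) \/ tr x = 0.
  move=> xA nsx; have [regx|] := boolP (regular x).
    by left; exists x => //; apply: (subsetP (expgs_leq A1 _)) xA.
  rewrite /regular negb_and !negbK => /orP[/eqP|/eqP t4]; first by right.
  by left; apply: regular_of_parabolic t4.
case: (decide u) => // [|tu]; first exact: A12.
have [h hA nh] := moved nsu.
case: (decide h (A12 _ hA) (moved_nonscalar nh)) => // th.
have uhA : (u * h)%g \in (A ^+ 2)%g by apply: (mem_expgsM (mem_expgs1 uA)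
  (mem_expgs1 hA)).
have uG : u \in SL2 F by apply: (AG (n := 1)).
have hG : h \in SL2 F by apply: (AG (n := 1)).
have du := SL2_det uG; have dh := SL2_det hG.
have hd : ed h = - ea h by apply/eqP; rewrite -addr_eq0 addrC -th.
have ud : ed u = - ea u by apply/eqP; rewrite -addr_eq0 addrC -tu.
have nsuh : nonscalar (u * h)%g.
  apply/negP => /and3P[/eqP b0 /eqP c0 /eqP ad]; case/negP: (nh 1).
  move: b0 c0 ad; rewrite !mulE /normalises hd ud => b0 c0 ad.
  apply/and4P; split; apply/eqP.
  - by apply: (eq_comb1 (k1 := - 2%:R) ad); ring.
  - by apply: (eq_comb1 (k1 := - 2%:R * 2%:R) b0); ring.
  - by apply: (eq_comb1 (k1 := - 2%:R * 2%:R) c0); ring.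
  - by apply: (eq_comb1 (k1 := 2%:R) ad); ring.
case: (decide _ uhA nsuh) => // tuh; case/negP: (nh (-1)).
move: tuh; rewrite /tr !mulE /normalises hd ud => tuh.
apply/and4P; split; apply/eqP.
- by apply: (eq_comb1 (k1 := 2%:R) tuh); ring.
- by ring.
- by ring.
- by apply: (eq_comb1 (k1 := 2%:R) tuh); ring.
Qed.

End Escape.

(** * Growth *)

Local Open Scope nat_scope.

(** * Arithmetic of exponents when growth fails *)

Section Numerics.
Variables K n N m g q : nat.
Hypotheses (n_gt0 : 0 < n) (small_growth : N ^ 30 < n ^ 31).

(** Taking the power [r] turns [N ^ f] into [N ^ 30], which failing growth replaces by [n ^ 31]. *)
Let power_bound c e f r : n ^ e <= c * N ^ f -> f * r = 30 ->
  n ^ (e * r) <= c ^ r * n ^ 31.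
Proof.
move=> le fr; rewrite expnM; apply: leq_trans (_ : (c * N ^ f) ^ r <= _).
  by case: (posnP r) => [->|r0]; [rewrite !expn0 | rewrite leq_exp2r].
by rewrite expnMn -expnM fr leq_mul2l (ltnW small_growth) orbT.
Qed.

Let leq_power e : 0 < e -> n <= n ^ e.
Proof. by move=> e0; rewrite -{1}[n]expn1 leq_pexp2l. Qed.

Hypothesis torus : n ^ 3 <= K * N ^ 2 * m ^ 3.

(** Eliminating [m] gives [n ^ 6 <= c * N ^ 5]; the sixth power leaves [n ^ 5 <= c ^ 6]. *)
Lemma no_new_torus_small : n * m <= 6 * N -> n <= (K * 6 ^ 3) ^ 6.
Proof.
move=> le.
have : n ^ 6 <= (K * 6 ^ 3) * N ^ 5.
  apply: leq_trans (_ : K * N ^ 2 * (n * m) ^ 3 <= _).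
    by rewrite expnMn mulnCA -[n ^ 6]/(n ^ (3 + 3)) expnD leq_mul2l torus orbT.
  apply: leq_trans (_ : K * N ^ 2 * (6 * N) ^ 3 <= _).
    by rewrite leq_mul2l leq_exp2r // le orbT.
  by rewrite expnMn mulnACA -expnD.
move/(power_bound (r := 6))/(_ erefl); rewrite -[6 * 6]/(5 + 31) expnD.
rewrite leq_pmul2r ?expn_gt0 ?n_gt0 //; apply: leq_trans.
exact: leq_power.
Qed.

(** Here [n ^ 3 <= c * N ^ 2], and the power 15 leaves [n ^ 14 <= c ^ 15]. *)
Lemma few_torus_elements_small : m <= 12 -> n <= (K * 12 ^ 3) ^ 15.
Proof.
move=> le.
have : n ^ 3 <= (K * 12 ^ 3) * N ^ 2.
  by apply: leq_trans torus _; rewrite mulnAC leq_mul2r leq_mul2l leq_exp2r // le !orbT.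
move/(power_bound (r := 15))/(_ erefl); rewrite -[3 * 15]/(14 + 31) expnD.
rewrite leq_pmul2r ?expn_gt0 ?n_gt0 //; apply: leq_trans.
exact: leq_power.
Qed.

(** For [m >= 12] one has [m <= 2 * (m - 6)], which turns 4 into 8. Eliminating [m] and [q] gives
    [n ^ 3 * g ^ 2 <= c * N ^ 5], to be raised to the sixth power. *)
Lemma many_tori_large : 0 < g -> q ^ 3 <= 2 * g -> 12 <= m ->
  g * (m - 6) <= 4 * q * N -> g ^ 12 <= (K * (2 * 8 ^ 3)) ^ 6 * n ^ 13.
Proof.
move=> g_gt0 qg m12 le.
have gm : g * m <= 8 * q * N.
  have le2 : m <= 2 * (m - 6) by move: m12; clear; lia.
  by move: le le2; clear; nia.
have main : n ^ 3 * g ^ 2 <= (K * (2 * 8 ^ 3)) * N ^ 5.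
  rewrite -(leq_pmul2r g_gt0).
  apply: leq_trans (_ : K * N ^ 2 * (g * m) ^ 3 <= _).
    by rewrite expnMn [g ^ 3 * _]mulnC mulnA -mulnA -expnSr leq_mul2r torus orbT.
  apply: leq_trans (_ : K * N ^ 2 * (8 * q * N) ^ 3 <= _).
    by rewrite leq_mul2l leq_exp2r // gm orbT.
  apply: leq_trans (_ : K * N ^ 2 * (8 ^ 3 * (2 * g) * N ^ 3) <= _).
    by rewrite leq_mul2l !expnMn leq_mul2r leq_mul2l qg !orbT.
  rewrite -[N ^ 5]/(N ^ (2 + 3)) expnD; apply: eq_leq.
  by move: (8 ^ 3) (N ^ 2) (N ^ 3) => a b c; lia.
rewrite -(leq_pmul2l (_ : 0 < n ^ 18)); last by rewrite expn_gt0 n_gt0.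
apply: leq_trans (_ : (n ^ 3 * g ^ 2) ^ 6 <= _); first by rewrite expnMn -!expnM.
apply: leq_trans (_ : (K * (2 * 8 ^ 3) * N ^ 5) ^ 6 <= _); first by rewrite leq_exp2r.
rewrite expnMn -expnM [n ^ 18 * _]mulnCA -expnD leq_mul2l; apply/orP; right.
exact: ltnW small_growth.
Qed.

End Numerics.

(** If the conclusion failed, [g <= q ^ 3] would give [n ^ 9 <= 64 * g ^ 8]. The ninth power of the
    hypothesis then yields [g ^ 108 <= c ^ 54 * 64 ^ 13 * g ^ 104], too small for [g]. *)
Lemma growth_fails_large c n g q : 0 < g -> 1 < q -> g <= q ^ 3 ->
  g ^ 12 <= c ^ 6 * n ^ 13 -> c ^ 54 * 64 ^ 13 < g -> 2 * g ^ 3 < n ^ 3 * q.-1.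
Proof.
move=> g_gt0 q_gt1 gq le big; rewrite ltnNge; apply/negP => small.
have le9 : n ^ 9 <= 64 * g ^ 8.
  rewrite -(leq_pmul2r g_gt0).
  have le1 : n ^ 3 * q <= 4 * g ^ 3.
    have le2 : q <= 2 * q.-1 by move: q_gt1; clear; lia.
    by move: (n ^ 3) (g ^ 3) small le2 => a b; clear; nia.
  have le3 : (n ^ 3 * q) ^ 3 <= (4 * g ^ 3) ^ 3 by rewrite leq_exp2r.
  move: le3; rewrite (expnMn (n ^ 3)) (expnMn 4) -(expnM n) -(expnM g) => le3.
  apply: leq_trans (_ : n ^ 9 * q ^ 3 <= _); first by rewrite leq_mul2l gq orbT.
  by apply: leq_trans le3 _; rewrite -mulnA -expnSr.
have {}le : (g ^ 12) ^ 9 <= (c ^ 6 * n ^ 13) ^ 9 by rewrite leq_exp2r.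
move: le; rewrite expnMn -!expnM => le.
have : g ^ 108 <= c ^ 54 * (64 ^ 13 * g ^ 104).
  apply: leq_trans le _; rewrite leq_mul2l; apply/orP; right.
  rewrite mulnC (expnM _ 9 13); apply: leq_trans (_ : (64 * g ^ 8) ^ 13 <= _).
    by rewrite leq_exp2r.
  by rewrite expnMn -expnM.
rewrite mulnA -[108]/(4 + 104) expnD leq_pmul2r ?expn_gt0 ?g_gt0 //.
move: big; move: (c ^ 54 * 64 ^ 13) => b big le4.
have : g <= g ^ 4 by rewrite -{1}[g]expn1 leq_pexp2l.
by move/(leq_trans big)/leq_trans/(_ le4); rewrite ltnn.
Qed.

Local Open Scope nat_scope.

(** The invariant [f] is the trace. The slice bound is [card_trace_slice] for [H = A ^+ 4], whose
    cube is [A ^+ 12]. *)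
Lemma pivot_SL2 : exists K, forall (F : finFieldType) (A : {set {'GL_2[F]}}),
  (2%:R != 0 :> F)%R -> 1%g \in A -> A^-1%g = A -> <<A>>%g = SL2 F ->
  (exists2 y, y \in (A ^+ 2)%g & regular y) ->
  exists m, #|A| ^ 3 <= K * #|(A ^+ 12)%g| ^ 2 * m ^ 3 /\
    (#|A| * m <= 6 * #|(A ^+ 12)%g| \/
     #|SL2 F| * (m - 6) <= 4 * #|F| * #|(A ^+ 12)%g|).
Proof.
exists (14 ^ 3) => F A two0 A1 AV genA [y0 y0A regy0].
apply: (@pivot _ (SL2_group F) A F (@tr F) (@regular F) #|F| (14 ^ 3)) y0A regy0 => //.
- exact: trJ.
- exact: regularJ.
- move=> x y z yG regy; apply: commute_nonscalar_trans.
  exact: regular_nonscalar yG regy.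
- by move=> x xG; apply: card_cent_regular.
- by move=> x xG r; apply: card_cent_trace.
- by move=> x xG; apply: card_cent_irregular.
move=> y yG /andP[t0 t4].
have := @card_trace_slice F (A ^+ 4)%g (tr y) _ _ _ t0 t4; rewrite -expgM; apply.
- exact: expgs_one.
- exact: expgs_inv.
- by rewrite gen_expgs_pos.
Qed.

(* [k] is 30; it is kept abstract so that [k ^ k] is never evaluated. *)
Lemma growth : exists k c : nat, 0 < k /\
  forall (F : finFieldType) (A : {set {'GL_2[F]}}),
  (2%:R != 0 :> F)%R -> 1%g \in A -> A^-1%g = A -> <<A>>%g = SL2 F ->
  (exists2 y, y \in (A ^+ 2)%g & regular y) ->
  c < #|A| -> c < #|SL2 F| ->
  (A ^+ 64)%g = SL2 F \/ #|A| ^ k.+1 <= #|(A ^+ 12)%g| ^ k.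
Proof.
have [K pivotK] := pivot_SL2.
(* [c1] excludes a missed torus, [c2] excludes [m <= 12], and [c3] makes [A] large enough for
   [large_set_covers]. *)
pose c1 := (K * 6 ^ 3) ^ 6; pose c2 := (K * 12 ^ 3) ^ 15.
pose c3 := (K * (2 * 8 ^ 3)) ^ 54 * 64 ^ 13.
exists 30, (c1 + c2 + c3); split=> // F A two0 A1 AV genA regA bigA bigG.
have sAG : A \subset SL2 F by rewrite -genA subset_gen.
case: (leqP (#|A| ^ 31) (#|(A ^+ 12)%g| ^ 30)) => small; [by right | left].
apply: large_set_covers => //.
have lt1 : c1 < #|A| by apply: leq_ltn_trans bigA; rewrite -addnA leq_addr.
have lt2 : c2 < #|A| by apply: leq_ltn_trans bigA; rewrite addnAC leq_addl.
have lt3 : c3 < #|SL2 F| by apply: leq_ltn_trans bigG; rewrite leq_addl.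
have A0 : 0 < #|A| by apply: leq_ltn_trans lt1.
have G0 : 0 < #|SL2 F| by apply: leq_ltn_trans lt3.
have [m [torus]] := pivotK F A two0 A1 AV genA regA.
case=> [/(no_new_torus_small A0 small torus)|le]; first by rewrite leqNgt lt1.
have m12 : 12 <= m.
  rewrite leqNgt; apply/negP => /ltnW/(few_torus_elements_small A0 small torus).
  by rewrite leqNgt lt2.
have le12 := many_tori_large A0 small torus G0 (card_SL2_ge F) m12 le.
exact: growth_fails_large G0 (card_field_gt1 F) (card_SL2_le F) le12 lt3.
Qed.

(** * Iterating the growth step *)

Lemma expn_bernoulli k n : k ^ n * (k + n) <= k.+1 ^ n * k.
Proof.
elim: n => [|n IHn]; first by rewrite !expn0 addn0.
rewrite !expnS -(mulnA k.+1); apply: leq_trans (leq_mul (leqnn k.+1) IHn).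
by move: (k ^ n) => a; nia.
Qed.

(** Each step raises to the power [1 + 1 / k], so by Bernoulli [k] steps at least square. Exponents
    are multiplied by [k ^ (k * j)] to stay integral. *)
Lemma superexponential (a : nat -> nat) k j g : 0 < k -> 1 < a 0 ->
  (forall i, i < k * j -> a i ^ k.+1 <= a i.+1 ^ k) -> a (k * j) <= g ->
  2 ^ 2 ^ j <= g.
Proof.
move=> k0 a0 step; apply: leq_trans.
have iter i : i <= k * j -> a 0 ^ (k.+1 ^ i) <= a i ^ (k ^ i).
  elim: i => [|i IHi] lei; first by rewrite !expn0 !expn1.
  rewrite !expnSr !expnM; apply: leq_trans (_ : (a i ^ k ^ i) ^ k.+1 <= _).
    by rewrite leq_exp2r // IHi // ltnW.
  by rewrite -!expnM ![k ^ i * _]mulnC !expnM leq_exp2r ?expn_gt0 ?k0 // step.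
have double : 2 ^ j * k ^ (k * j) <= k.+1 ^ (k * j).
  have le : 2 * k ^ k <= k.+1 ^ k.
    rewrite -(leq_pmul2r k0); apply: leq_trans (expn_bernoulli k k).
    by rewrite addnn -mul2n mulnA [k ^ k * 2]mulnC.
  rewrite !expnM -expnMn; case: (posnP j) => [->|j0]; first by rewrite !expn0.
  by rewrite leq_exp2r.
rewrite -(leq_exp2r _ _ (_ : 0 < k ^ (k * j))); last by rewrite expn_gt0 k0.
apply: leq_trans (iter _ (leqnn _)); rewrite -expnM.
apply: leq_trans (_ : a 0 ^ (2 ^ j * k ^ (k * j)) <= _);
  first by rewrite leq_exp2r // muln_gt0 !expn_gt0 k0.
by rewrite leq_pexp2l // ltnW.
Qed.

Lemma symmetric_diameter : exists c e : nat,
  forall (F : finFieldType) (S : {set {'GL_2[F]}}),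
  (2%:R != 0 :> F)%R -> (3%:R != 0 :> F)%R ->
  1%g \in S -> S^-1%g = S -> <<S>>%g = SL2 F -> c < #|SL2 F| ->
  (S ^+ (c * (2 * trunc_log 2 #|SL2 F|) ^ e))%g = SL2 F.
Proof.
have [k [c [k0 growthF]]] := growth.
(* The power [c + 14] has more than [c] elements, and its square contains the regular element of
   length 14; 64 is the covering length in [growth]. *)
exists ((c + 14) * 64), (4 * k) => F S two0 three0 S1 SV genS bigG.
pose G := SL2_group F; pose m := c + 14.
have m0 : 0 < m by rewrite addn_gt0 orbT.
have sSG n : (S ^+ n)%g \subset SL2 F.
  by apply: (expgs_sub (G := G)); rewrite /= -genS subset_gen.
(* [L < 2 ^ j <= 2 * L]: so [k * j] rounds of growth would exceed [#|G|], and [12 ^ (k * j)] is at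
   most [(2 * L) ^ (4 * k)] because [12 <= 2 ^ 4]. *)
set L := trunc_log 2 _; pose j := (trunc_log 2 L).+1.
have mG : m < #|G| by apply: leq_ltn_trans bigG; rewrite leq_pmulr.
pose r i := m * 12 ^ i.
have r0 i : 0 < r i by rewrite muln_gt0 m0 expn_gt0.
have rm i : m <= r i by rewrite leq_pmulr ?expn_gt0.
have covered : [exists i : 'I_(k * j), (S ^+ (r i * 64))%g == SL2 F].
  apply: contraT => /existsPn none; exfalso.
  have : 2 ^ 2 ^ j <= #|G|.
    apply: (@superexponential (fun i => #|(S ^+ r i)%g|) k) => //; last first.
    - exact: subset_leq_card.
    - move=> i lti.
      have S1r : 1%g \in (S ^+ r i)%g by apply: expgs_one.
      have genr : <<S ^+ r i>>%g = SL2 F by rewrite gen_expgs_pos.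
      have bigr : c < #|(S ^+ r i)%g|.
        apply: leq_trans (subset_leq_card (expgs_leq S1 (rm i))).
        apply: leq_trans (card_expgs_gt (G := G) S1 genS mG).
        by rewrite ltnS leq_addr.
      have reg : exists2 y, y \in ((S ^+ r i) ^+ 2)%g & regular y.
        have [y yS regy] := regular_element two0 three0 S1 SV genS; exists y => //.
        apply: (subsetP _ _ yS); rewrite -expgM; apply: expgs_leq => //.
        by apply: leq_trans (leq_pmulr _ _) => //; apply: leq_trans (rm i);
          apply: leq_addl.
      have bigG' : c < #|SL2 F| by apply: leq_ltn_trans mG; apply: leq_addr.
      case: (growthF F _ two0 S1r (expgs_inv _ SV) genr reg bigr bigG').
        by rewrite -expgM => covi; have := none (Ordinal lti); rewrite /= covi eqxx.
      by rewrite -expgM -mulnA -expnSr.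
    apply: leq_trans (card_expgs_gt (G := G) S1 genS _); last first.
      by apply: leq_trans mG; rewrite /r expn0 muln1.
    by rewrite ltnS r0.
  rewrite leqNgt => /negP[].
  apply: leq_trans (trunc_log_ltn _ (isT : 1 < 2)) _; rewrite -/L leq_pexp2l //.
  exact: trunc_log_ltn.
have [i /eqP covi] := existsP covered.
apply/eqP; rewrite eqEsubset sSG /=.
apply: subset_trans (_ : (S ^+ (r i * 64))%g \subset _); first by rewrite covi.
apply: expgs_leq => //.
rewrite /r -/m mulnAC leq_mul2l; apply/orP; right.
apply: leq_trans (_ : (2 ^ 4) ^ (k * j) <= _).
  apply: leq_trans (_ : 12 ^ (k * j) <= _); first by rewrite leq_pexp2l // ltnW.
  by rewrite leq_exp2r // muln_gt0 k0.
rewrite -expnM mulnA mulnC expnM leq_exp2r ?muln_gt0 ?k0 //.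
rewrite expnS leq_mul2l /=; apply: trunc_logP => //.
rewrite trunc_log_gt0 /=; apply: leq_ltn_trans mG.
by rewrite /m (leq_trans _ (leq_addl _ _)).
Qed.

(** * Diameter *)

Local Open Scope nat_scope.

(** Dropping the factors [1] turns a word over [1 |: A] into a word over [A] that is no longer. *)
Lemma diameter_le (gT : finGroupType) (G : {group gT}) (A : {set gT})
    (genA : <<A>>%g = G) n :
  ((1 |: A) ^+ n)%g = G -> diameter genA <= n.
Proof.
move=> covG; rewrite /diameter; case: ex_minnP => k _; apply.
apply/forall_inP => g; rewrite -covG.
suff short r x : x \in ((1 |: A) ^+ r)%g -> exists2 s, s <= r & x \in (A ^+ s)%g.
  by case/short=> s les gA; apply/existsP; exists (Ordinal (les : s < n.+1)).
elim: r x => [|r IHr] x; first by exists 0.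
rewrite expgS => /mulsgP[a y + /IHr[s les yA] ->].
rewrite !inE => /orP[/eqP-> | aA]; first by exists s; rewrite ?mul1g // leqW.
by exists s.+1; rewrite ?ltnS // expgS mem_mulg.
Qed.

Lemma Fp_natr_neq0 p n : prime p -> 0 < n < p -> (n%:R != 0 :> 'F_p)%R.
Proof.
move=> p_pr /andP[n0 ltnp]; rewrite -(dvdn_pcharf (pchar_Fp p_pr)).
by rewrite gtnNdvd.
Qed.

(** An order above [27 = 3 ^ 3] forces [p > 3], so that 2 and 3 are invertible. Groups of order at
    most [c + 27] are covered by words of length their order. The extra factor [2 * L] pays for
    [directed_diameter]. *)
Lemma diameter_SL2_Fp : exists c e : nat, forall p, prime p ->
  forall (A : {set {'GL_2['F_p]}}) (genA : <<A>>%g = SL2_group 'F_p),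
  diameter genA <= c * (2 * trunc_log 2 #|SL2 'F_p|) ^ e.
Proof.
have [c [e symdiam]] := symmetric_diameter.
exists (4 * (c + 27)), e.+1 => p p_pr A genA.
pose S := (1 |: (A :|: A^-1))%g; pose G := SL2_group 'F_p.
have S1 : 1%g \in S by apply: setU11.
have SV : S^-1%g = S by apply: symmetric_closure_inv.
have genS : <<S>>%g = G by rewrite gen_symmetric_closure.
set L := trunc_log 2 _.
have G4 : 4 <= #|G| by apply: card_SL2_ge4.
have L0 : 0 < L by rewrite trunc_log_gt0 /= (leq_trans _ G4).
pose d := (c + 27) * (2 * L) ^ e.
have pow0 : 0 < (2 * L) ^ e by rewrite expn_gt0 muln_gt0 L0.
have covS : (S ^+ d)%g = G.
  have sSG : (S ^+ d)%g \subset G by apply: expgs_sub; rewrite -genS subset_gen.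
  apply/eqP; rewrite eqEsubset sSG /=.
  have [big|small] := ltnP (c + 27) #|G|.
    have p3 : 3 < p.
      have := card_SL2_le 'F_p; rewrite card_Fp // => le.
      rewrite ltnNge; apply/negP => p3; move: big; rewrite ltnNge => /negP[].
      apply: leq_trans le _; apply: leq_trans (_ : 3 ^ 3 <= _);
        first by rewrite leq_exp2r.
      by rewrite leq_addl.
    have two0 : (2%:R != 0 :> 'F_p)%R by apply: Fp_natr_neq0 => //=; apply: ltnW.
    have three0 : (3%:R != 0 :> 'F_p)%R by apply: Fp_natr_neq0; rewrite // p3.
    have bigc : c < #|G| by apply: leq_ltn_trans big; rewrite leq_addr.
    rewrite -(symdiam _ _ two0 three0 S1 SV genS bigc) expgs_leq //.
    by rewrite leq_mul2r leq_addr orbT.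
  rewrite -(expgs_card S1 genS) expgs_leq //; apply: leq_trans small _.
  by rewrite leq_pmulr.
apply: leq_trans (diameter_le genA (directed_diameter genA covS)) _.
have -> : 4 * (c + 27) * (2 * L) ^ e.+1 = 4 * d * (2 * L).
  by rewrite /d expnS [(2 * L * _)%N]mulnC !mulnA.
by rewrite -[trunc_log _ _]/L leq_mul2l [(2 * L)%N]mul2n -addnn -[L.+1]addn1
  leq_add2l L0 orbT.
Qed.

(** * From binary to natural logarithms *)

Local Open Scope ring_scope.

(** This is [ln (1 + x) <= x] at [x = - 1 / 2]. *)
Lemma ln2_ge_half (R : realType) : 2^-1 <= ln 2 :> R.
Proof.
have half : - 1 < - 2^-1 :> R by rewrite ltrN2 invf_lt1 ?ltr1n.
have := le_ln1Dx half.
rewrite (_ : 1 - 2^-1 = 2^-1 :> R); last by field.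
by rewrite lnV ?posrE // lerN2.
Qed.

Lemma trunc_log_le_ln (R : realType) n : (0 < n)%N ->
  (2 * trunc_log 2 n)%:R <= 4 * ln (n%:R : R).
Proof.
move=> n0; set L := trunc_log 2 n.
have le : L%:R * ln 2 <= ln (n%:R : R).
  rewrite mulr_natl -lnXn // -natrX ler_ln ?posrE ?ltr0n ?expn_gt0 //.
  by rewrite ler_nat trunc_logP.
have : L%:R * 2^-1 <= L%:R * ln 2 :> R by rewrite ler_wpM2l ?ler0n ?ln2_ge_half.
move/le_trans/(_ le) => {}le.
rewrite natrM (_ : 2 * L%:R = 4 * (L%:R * 2^-1) :> R); last by field.
by rewrite ler_wpM2l.
Qed.

Lemma ln_ge1 (R : realType) n : (4 <= n)%N -> 1 <= ln (n%:R : R).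
Proof.
move=> n4; apply: le_trans (_ : ln (2%:R ^+ 2 : R) <= _).
  rewrite lnXn // mulr2n [leLHS](_ : 1 = 2^-1 + 2^-1 :> R); last by field.
  by rewrite lerD ?ln2_ge_half.
rewrite ler_ln ?posrE ?exprn_gt0 ?ltr0n //; last exact: leq_trans n4.
by rewrite -natrX ler_nat.
Qed.

Theorem corollary1p2 (R : realType) :
  exists C : R, 0 < C /\
    forall p : nat, prime p ->
    forall (A : {set {'GL_2['F_p]}})
      (genA : <<A>>%g = SL2_group 'F_p :> {set {'GL_2['F_p]}}),
      (diameter genA)%:R <= C * ln (#|SL2 'F_p|%:R : R) `^ C.
Proof.
have [c [e diam]] := diameter_SL2_Fp.
(* The logarithm being at least 1, one constant serves as factor and as exponent; the summand [e.+1]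
   bounds the exponent and keeps [C] positive. *)
pose C : R := (c * 4 ^ e + e.+1)%:R; exists C; split; first by rewrite ltr0n addnS.
move=> p p_pr A genA; set x := ln _.
have G4 : (4 <= #|SL2 'F_p|)%N by apply: card_SL2_ge4.
have x1 : 1 <= x by apply: ln_ge1.
have x0 : 0 <= x by apply: le_trans x1.
apply: le_trans (_ : c%:R * (4 * x) ^+ e <= _).
  apply: le_trans (_ : (c * (2 * trunc_log 2 #|SL2 'F_p|) ^ e)%:R <= _).
    by rewrite ler_nat diam.
  rewrite natrM natrX ler_wpM2l ?ler0n // lerXn2r ?nnegrE ?ler0n ?mulr_ge0 //.
  by apply: trunc_log_le_ln; apply: leq_trans G4.
rewrite exprMn mulrA -natrX -natrM; apply: ler_pM; rewrite ?ler0n ?exprn_ge0 //.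
  by rewrite ler_nat leq_addr.
rewrite -powR_mulrn //; apply: ler_powR => //.
by rewrite ler_nat (leq_trans (leqnSn e)) ?leq_addl.
Qed.
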